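(* Let $\Phi$ be a local interaction on $V$ satisfying the Commuting Hypothesis, let $\mathbf b:\mathcal P_f(V)\to[0,\infty)$ be subadditive with $$\|\Phi\|_{\mathbf b}:=\sup_{x\in V}\sum_{X\ni x}\|\Phi_X\|\,e^{\mathbf b(X)}<\infty,$$ and suppose the system has finite degree $\mathfrak d\in\mathbb N$. Then for every real $\beta$ with $|\beta|<\frac{1}{\mathfrak d(1+\mathfrak d)e^2\|\Phi\|_{\mathbf b}}$ and every $L\subset V$ there exists a local interaction $\widetilde\Phi^{L,\beta}$ on $V$ such that: (i) $\widetilde\Phi^{L,\beta}_X$ is supported in $X\cap L$ for every finite $X$; (ii) if $L'\subset V$, then $\widetilde\Phi^{L,\beta}_X=\widetilde\Phi^{L',\beta}_X$ for every finite $X$ with $X\cap L'=X\cap L$; (iii) for every finite $\Lambda\subset V$, $\log\mathbb E_L[e^{-\beta H_\Lambda}]=\sum_{X\subset\Lambda}\widetilde\Phi^{L,\beta}_X$; and moreover $\sup_{x\in V}\sum_{X\ni x}\|\widetilde\Phi^{L,\beta}_X\|\,e^{\mathbf b(X)}\le 1$.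
   Context: $V$ is a set with a metric; $\mathcal P_f(V)$ denotes the finite subsets of $V$. Each site carries $\mathbb C^D$; for finite $X$, $\mathfrak A_X=\mathcal B(\bigotimes_{v\in X}\mathbb C^D)$, embedded in $\mathfrak A_Y$ for $X\subset Y$ via $Q\mapsto Q\otimes\mathbb 1$; $\mathfrak A_{loc}=\bigcup_X\mathfrak A_X$. A local interaction is a family $(\Phi_X)_{X\in\mathcal P_f(V)}$ with $\Phi_X=\Phi_X^*\in\mathfrak A_X$; $H_\Lambda=\sum_{X\subset\Lambda}\Phi_X$. For $L\subset V$ and $Q\in\mathfrak A_\Lambda$, $\mathbb E_L[Q]=D^{-|\Lambda\setminus L|}\operatorname{tr}_{\Lambda\setminus L}(Q)\otimes\mathbb 1_{\Lambda\setminus L}$ (normalized partial trace over sites outside $L$). $\log$ is the self-adjoint logarithm of a positive definite operator. Subadditive: $\mathbf b(X\cup Y)\le\mathbf b(X)+\mathbf b(Y)$. Commuting Hypothesis: there is a commutative algebra $\mathcal A\subset\mathfrak A_{loc}$ with $\Phi_X\in\mathcal A$ for all $X$ and $\mathbb E_L[\mathcal A]\subset\mathcal A$ for every $L\subset V$. Let $\mathcal S=\{X\in\mathcal P_f(V):\Phi_X\neq0\}$; the system has finite degree $\mathfrak d$ if for every $X\in\mathcal S$ the number of $Y\in\mathcal S$ with $Y\cap X\neq\emptyset$ is at most $\mathfrak d$. *)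

(* Defs.v *)
(* mathcomp 2.5 + mathcomp-analysis 1.16 + finmap + real-closed complex *)
From HB Require Import structures.
From mathcomp Require Import all_boot all_order all_algebra.
From mathcomp Require Import all_classical all_reals all_analysis.
From mathcomp Require Import complex finmap.

Set Implicit Arguments.
Unset Strict Implicit.
Unset Printing Implicit Defensive.

Import Order.TTheory GRing.Theory Num.Theory.
Import numFieldNormedType.Exports.
Local Open Scope classical_set_scope.
Local Open Scope fset_scope.
Local Open Scope ring_scope.

(** The complex numbers, realised as [R[i]] over a real type [R]. *)
Definition CC (R : realType) : numClosedFieldType := R[i].

(** Real scalars inside [CC R]. *)
Definition rC (R : realType) (x : R) : CC R := Complex x 0.

Section QuantumSpinSystem.
Variables (R : realType) (V : choiceType) (D : nat).

(** Sites [v] carry [C^D]; the basis of [bigotimes_{v in X} C^D] is indexed by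
    configurations [X -> 'I_D]. *)
Definition conf (X : {fset V}) := {ffun X -> 'I_D}.

(** [A_X = B(bigotimes_{v in X} C^D)], as square matrices over [CC R] whose
    rows/columns are indexed (via [enum_rank]) by the configurations on [X]. *)
Definition Op (X : {fset V}) := 'M[CC R]_#|{: conf X}|.

Definition opent (X : {fset V}) (Q : Op X) (s t : conf X) : CC R :=
  Q (enum_rank s) (enum_rank t).

Definition mkOp (X : {fset V}) (f : conf X -> conf X -> CC R) : Op X :=
  \matrix_(i, j) f (enum_val i) (enum_val j).

(** Adjoint (conjugate transpose). *)
Definition adj (n : nat) (A : 'M[CC R]_n) : 'M[CC R]_n :=
  (map_mx (fun z : CC R => z^*) A)^T.

(** Restriction of a configuration on [Y] to a subset [X]. *)
Definition restr (X Y : {fset V}) (h : X `<=` Y) (s : conf Y) : conf X :=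
  [ffun x => s (fincl h x)].

(** The embedding [A_X -> A_Y], [Q |-> Q (x) 1_{Y \ X}], for [X \subset Y]. *)
Definition embP (X Y : {fset V}) (h : X `<=` Y) (Q : Op X) : Op Y :=
  mkOp (fun s t =>
    if [forall y : Y, (val y \notin X) ==> (s y == t y)]
    then opent Q (restr h s) (restr h t) else 0).

(** Total version (the value when [X] is not a subset of [Y] is irrelevant:
    it is only ever used with [X \subset Y]). *)
Definition emb (X Y : {fset V}) (Q : Op X) : Op Y :=
  (if fsubset X Y as b return fsubset X Y = b -> Op Y
   then fun h => embP h Q else fun _ => 0) erefl.

(** Operator norm, w.r.t. the Euclidean norm on [C^n]. *)
Definition vnorm (n : nat) (v : 'cV[CC R]_n) : R :=
  Num.sqrt (\sum_i @complex.Re R (`|v i ord0| ^+ 2)).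

Definition opnorm (n : nat) (A : 'M[CC R]_n) : R :=
  sup [set vnorm (A *m v) | v in [set v : 'cV[CC R]_n | vnorm v <= 1]].

(** Matrix exponential [e^A = sum_k A^k / k!]. *)
Definition mexp (n : nat) (A : 'M[CC R]_n) : 'M[CC R]_n :=
  limn (series (fun k : nat => (k`!%:R)^-1 *: A ^+ k)).

(** Self-adjoint logarithm: the unique self-adjoint [L] with [e^L = P]
    (exists exactly when [P] is positive definite; default [0] otherwise). *)
Definition mlog (n : nat) (P : 'M[CC R]_n) : 'M[CC R]_n :=
  xget 0 [set L : 'M[CC R]_n | adj L = L /\ mexp L = P].

(** Local interactions. *)
Definition interaction := forall X : {fset V}, Op X.

Definition local_interaction (Phi : interaction) : Prop :=
  forall X, adj (Phi X) = Phi X.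

(** [H_Lambda = sum_{X subset Lambda} Phi_X]. *)
Definition ham (Phi : interaction) (Lam : {fset V}) : Op Lam :=
  \sum_(X <- fpowerset Lam) emb Lam (Phi X).

(** [X cap L] for finite [X] and arbitrary [L subset V]. *)
Definition fsetIs (X : {fset V}) (L : set V) : {fset V} :=
  [fset x in X | `[< L x >]].

(** Glue: the configuration equal to [t] on [L] and to [r] off [L]. *)
Definition cglue (Lam : {fset V}) (L : set V) (r t : conf Lam) : conf Lam :=
  [ffun x => if `[< L (val x) >] then t x else r x].

(** Normalized partial trace
    [E_L[Q] = D^{-|Lam \ L|} tr_{Lam \ L}(Q) (x) 1_{Lam \ L}], for [Q in A_Lam]. *)
Definition econd (L : set V) (Lam : {fset V}) (Q : Op Lam) : Op Lam :=
  mkOp (fun s t =>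
    if [forall x : Lam, ~~ `[< L (val x) >] ==> (s x == t x)]
    then ((D%:R : CC R) ^+ #|[pred x : Lam | ~~ `[< L (val x) >]]|)^-1 *
         \sum_(r : conf Lam | [forall x : Lam, `[< L (val x) >] ==> (r x == s x)])
            opent Q r (cglue L r t)
    else 0).

(** [Q in A_X] is supported in [Z subset X]: [Q in A_Z subset A_X]. *)
Definition supported_in (X Z : {fset V}) (Q : Op X) : Prop :=
  exists B : Op Z, Q = emb X B.

(** Commuting Hypothesis: a commutative algebra [A subset A_loc]
    (given levelwise, compatibly with the embeddings [A_X subset A_Y]) containing
    every [Phi_X] and stable under every [E_L]. *)
Definition commuting_hyp (Phi : interaction) : Prop :=
  exists A : forall X : {fset V}, set (Op X),
    [/\ (forall (X Y : {fset V}) (Q : Op X), X `<=` Y -> (A X Q <-> A Y (emb Y Q))),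
        (forall X (Q P : Op X), A X Q -> A X P ->
            [/\ A X (Q + P), A X (Q * P) & Q * P = P * Q]),
        (forall X (c : CC R) (Q : Op X), A X Q -> A X (c *: Q)),
        (forall X, A X (Phi X))
      & (forall (L : set V) (Lam : {fset V}) (Q : Op Lam), A Lam Q -> A Lam (econd L Q))].

(** Finite degree [d]: every [X in S] meets at most [d] elements of [S],
    where [S = {X | Phi_X <> 0}]. *)
Definition finite_degree (Phi : interaction) (d : nat) : Prop :=
  forall X : {fset V}, Phi X != 0 ->
    forall Ys : {fset {fset V}},
      (forall Y, Y \in Ys -> Phi Y != 0 /\ Y `&` X != fset0) -> (#|` Ys| <= d)%N.

Definition b_subadditive (b : {fset V} -> R) : Prop :=
  forall X Y : {fset V}, b (X `|` Y) <= b X + b Y.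

(** [||Phi||_b = sup_x sum_{X ni x} ||Phi_X|| e^{b(X)}] (extended real). *)
Definition bnorm (b : {fset V} -> R) (Phi : interaction) : \bar R :=
  ereal_sup [set (\esum_(X in [set X : {fset V} | x \in X])
                    (opnorm (Phi X) * expR (b X))%:E)%E | x in [set: V]].

End QuantumSpinSystem.

(* Main.v *)
(** Write [Z(B)] for the partial trace of [exp (- beta * sum_(X in B) Phi_X)], where
    [B] is a finite family of nonempty sets with [Phi_X <> 0].  The effective
    interaction at [X] collects the Moebius coefficients of [B |-> log Z(B)] over the
    families [B] with union [X]; summing over all [X] inside [Lam] then gives [log Z]
    back.

    For the norm bound, set functions are measured by the sum of the norms of their
    Moebius coefficients, weighted by [exp (b (union of B))].  By subadditivity of [b]
    this norm is submultiplicative, since the Moebius coefficients of a product are the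
    union-convolution of those of the factors.  Removing one set [X] changes [Z] by a
    factor [1 + r] with [r = E[f_X e^{-beta H}] / Z] and [f_X = exp (- beta Phi_X) - 1].
    An induction on the number of sets present shows that the ratio [E[Q e^{-beta H}] / Z]
    has norm at most [|Q| ((d + 2) / d)^n], with [n] the number of sets meeting the
    support of [Q]: each removal costs [(1 + eps) / (1 - eps)] with [eps = 1 / (d + 1)],
    and once no set meets the support of [Q], the conditional expectation factorizes.
    The smallness of [beta] makes [r] at most [eps].  Hence [log (1 + r)], the integral
    over [t] in [0, 1] of [r / (1 + t r)], has norm at most [eps / (1 - eps) = 1 / d].
    The coefficients of [log Z] at families containing [X] are those of [log (1 + r)],
    and at most [d] sets [X] contain a given site. *)

(* The Moebius coefficient at one family involves all of its subfamilies, so the induction must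
   bound whole set functions: [A] is the family still present, [B] runs over the subfamilies of a
   fixed [U], and the data depend on [A] intersected with [B]. Commutativity makes this a
   scalar-like calculus, in which the logarithm of a product is a sum. The factor e^2 in the bound
   on [beta] arises as follows: one removal costs 1 + 2 / d, at most e^(2 / d); since a set meets
   itself, at most d - 1 others are charged to it; and e^(|beta| |Phi_X|) is at most another e^(2 /
   d). The empty set stands apart: its term is a scalar attached to no site, so it is kept out of
   the families and restored in the effective interaction. All estimates take place in one finite
   volume; [log Z] of a family commutes with embeddings, so its coefficients do not depend on that
   volume. The integral for log (1 + r) is replaced by Riemann sums, whose remainder is small in
   operator norm and hence, [U] being finite, in the weighted norm. *)
From HB Require Import structures.
From mathcomp Require Import all_boot all_order all_algebra.
From mathcomp Require Import all_classical all_reals all_analysis.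
From mathcomp Require Import complex finmap spectral ring lra.
Require Import Defs.
Import Order.TTheory GRing.Theory Num.Theory.
Import numFieldNormedType.Exports.
Local Open Scope classical_set_scope.
Local Open Scope fset_scope.
Local Open Scope ring_scope.
Set Implicit Arguments.
Unset Strict Implicit.
Unset Printing Implicit Defensive.

(** * Operator norm *)

Section OperatorNorm.
Variable R : realType.
Implicit Types (n : nat) (z : CC R) (x : R).

Definition nc z : R := @complex.Re R `|z|.

Lemma nc_sqrtE z :
  nc z = Num.sqrt ((@complex.Re R z) ^+ 2 + (@complex.Im R z) ^+ 2).
Proof. by rewrite /nc; case: z. Qed.

Lemma rC_nc z : rC (nc z) = `|z|.
Proof. by rewrite nc_sqrtE; case: z. Qed.

Lemma rC_inj : injective (@rC R).
Proof. by move=> x y []. Qed.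

Lemma rC_is_zmod_morphism : zmod_morphism (@rC R).
Proof. exact: (raddfB (real_complex R)). Qed.
Lemma rC_is_monoid_morphism : monoid_morphism (@rC R).
Proof.
split; [exact: (rmorph1 (real_complex R))|exact: (rmorphM (real_complex R))].
Qed.
HB.instance Definition _ :=
  GRing.isZmodMorphism.Build R (CC R) (@rC R) rC_is_zmod_morphism.
HB.instance Definition _ :=
  GRing.isMonoidMorphism.Build R (CC R) (@rC R) rC_is_monoid_morphism.

Lemma nc_ge0 z : 0 <= nc z.
Proof. by rewrite nc_sqrtE sqrtr_ge0. Qed.

Lemma ncM z1 z2 : nc (z1 * z2) = nc z1 * nc z2.
Proof. by apply: rC_inj; rewrite rmorphM !rC_nc normrM. Qed.

Lemma nc0 : nc 0 = 0.
Proof. by apply: rC_inj; rewrite rC_nc normr0 rmorph0. Qed.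

Lemma nc1 : nc 1 = 1.
Proof. by apply: rC_inj; rewrite rC_nc normr1 rmorph1. Qed.

Lemma nc_rC x : nc (rC x) = `|x|.
Proof. by rewrite nc_sqrtE /= expr0n addr0 sqrtr_sqr. Qed.

Lemma ler_rC x y : (rC x <= rC y) = (x <= y).
Proof. exact: lecR. Qed.

Lemma ltr_rC x y : (rC x < rC y) = (x < y).
Proof. exact: ltcR. Qed.

Lemma ncD z1 z2 : nc (z1 + z2) <= nc z1 + nc z2.
Proof. by rewrite -ler_rC rmorphD !rC_nc; exact: ler_normD. Qed.

Lemma nc_eq0 z : nc z = 0 -> z = 0.
Proof. by move=> z0; apply/eqP; rewrite -normr_eq0 -rC_nc z0 rmorph0. Qed.

Lemma conj_rC x : (rC x)^* = rC x :> CC R.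
Proof. by rewrite -[LHS]/(Complex x (- 0)) oppr0. Qed.

Lemma rC_real z : z^* = z -> z = rC (@complex.Re R z).
Proof.
case: z => a b; rewrite -[Num.conj _]/(Complex a (- b)) => -[] /eqP.
by rewrite eq_sym -subr_eq0 opprK -mulr2n mulrn_eq0 /= => /eqP ->.
Qed.

Lemma vnormE n (v : 'cV[CC R]_n) : vnorm v = Num.sqrt (\sum_i nc (v i ord0) ^+ 2).
Proof.
by congr Num.sqrt; apply: eq_bigr => i _; rewrite -rC_nc -rmorphXn.
Qed.

Lemma vnorm_ge0 n (v : 'cV[CC R]_n) : 0 <= vnorm v.
Proof. exact: sqrtr_ge0. Qed.

Lemma sqr_vnorm n (v : 'cV[CC R]_n) : vnorm v ^+ 2 = \sum_i nc (v i ord0) ^+ 2.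
Proof. by rewrite vnormE sqr_sqrtr// sumr_ge0// => i _; exact: sqr_ge0. Qed.

Lemma vnorm0 n : vnorm (0 : 'cV[CC R]_n) = 0.
Proof.
by rewrite vnormE big1 ?sqrtr0// => i _; rewrite mxE nc0 expr0n.
Qed.

Lemma vnorm_eq0 n (v : 'cV[CC R]_n) : vnorm v = 0 -> v = 0.
Proof.
move=> v0; apply/matrixP => i j; rewrite ord1 mxE; apply: nc_eq0; apply/eqP.
rewrite -sqrf_eq0; have /eqP := sqr_vnorm v.
rewrite v0 expr0n /= eq_sym psumr_eq0 => [/allP/(_ i)|? _]; last exact: sqr_ge0.
by rewrite mem_index_enum => /(_ isT).
Qed.

Lemma vnormZ n (c : CC R) (v : 'cV[CC R]_n) : vnorm (c *: v) = nc c * vnorm v.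
Proof.
apply: (@pexpIrn _ 2) => //; rewrite ?nnegrE ?mulr_ge0 ?vnorm_ge0 ?nc_ge0//.
rewrite exprMn !sqr_vnorm mulr_sumr; apply: eq_bigr => i _.
by rewrite mxE ncM exprMn.
Qed.

(** Cauchy-Schwarz by Lagrange's identity: twice the defect is the sum over i, j of (a_i c_j - a_j
    c_i)^2. *)
Lemma sqr_sum_mul_le n (a c : 'I_n -> R) :
  (\sum_i a i * c i) ^+ 2 <= (\sum_i a i ^+ 2) * (\sum_i c i ^+ 2).
Proof.
have two : (0 : R) < 2%:R by rewrite ltr0n.
rewrite -subr_ge0 -(pmulr_rge0 _ two) mulrBr.
suff -> : 2%:R * ((\sum_i a i ^+ 2) * (\sum_i c i ^+ 2)) -
          2%:R * (\sum_i a i * c i) ^+ 2 =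
          \sum_i \sum_j (a i * c j - a j * c i) ^+ 2.
  by do 2!apply: sumr_ge0 => ? _; exact: sqr_ge0.
have e1 : (\sum_i a i ^+ 2) * (\sum_i c i ^+ 2) =
          \sum_i \sum_j a i ^+ 2 * c j ^+ 2.
  by rewrite mulr_suml; apply: eq_bigr => i _; rewrite mulr_sumr.
have e2 : (\sum_i a i * c i) ^+ 2 = \sum_i \sum_j a i * c i * (a j * c j).
  by rewrite expr2 mulr_suml; apply: eq_bigr => i _; rewrite mulr_sumr.
have e3 : \sum_i \sum_j a i ^+ 2 * c j ^+ 2 = \sum_i \sum_j a j ^+ 2 * c i ^+ 2.
  by rewrite exchange_big.
rewrite e1 e2 [X in X - _]mulr_natl mulr2n {2}e3.
rewrite -big_split mulr_sumr -sumrB; apply: eq_bigr => i _.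
rewrite -big_split mulr_sumr -sumrB; apply: eq_bigr => j _ /=.
ring.
Qed.

Lemma vnormD n (v w : 'cV[CC R]_n) : vnorm (v + w) <= vnorm v + vnorm w.
Proof.
rewrite -(@ler_pXn2r _ 2) ?nnegrE ?addr_ge0 ?vnorm_ge0// sqr_vnorm.
apply: (@le_trans _ _ (\sum_i (nc (v i ord0) + nc (w i ord0)) ^+ 2)).
  apply: ler_sum => i _; rewrite mxE ler_pXn2r ?nnegrE ?addr_ge0 ?nc_ge0//.
  exact: ncD.
rewrite sqrrD !sqr_vnorm.
under eq_bigr do rewrite sqrrD.
rewrite 2!big_split /= lerD2r lerD2l sumrMnl ler_pMn2r//.
rewrite -(@ler_pXn2r _ 2) ?nnegrE ?mulr_ge0 ?vnorm_ge0//; last first.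
  by apply: sumr_ge0 => i _; rewrite mulr_ge0 ?nc_ge0.
by rewrite exprMn !sqr_vnorm; exact: sqr_sum_mul_le.
Qed.

Lemma vnorm_coord n (v : 'cV[CC R]_n) i : nc (v i ord0) <= vnorm v.
Proof.
rewrite -(@ler_pXn2r _ 2) ?nnegrE ?nc_ge0 ?vnorm_ge0// sqr_vnorm (bigD1 i)//=.
by rewrite lerDl sumr_ge0// => j _; exact: sqr_ge0.
Qed.

Lemma vnorm_sum I (r : seq I) (P : pred I) n (F : I -> 'cV[CC R]_n) :
  vnorm (\sum_(i <- r | P i) F i) <= \sum_(i <- r | P i) vnorm (F i).
Proof.
elim/big_ind2: _ => [|z a w c za wc|//]; first by rewrite vnorm0.
exact: le_trans (vnormD _ _) (lerD za wc).
Qed.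

Lemma vnorm_mulmx_bound n (A : 'M[CC R]_n) (v : 'cV[CC R]_n) :
  vnorm (A *m v) <= (\sum_j vnorm (col j A)) * vnorm v.
Proof.
have -> : A *m v = \sum_j v j ord0 *: col j A.
  apply/matrixP => i k; rewrite ord1 mxE summxE; apply: eq_bigr => j _.
  by rewrite !mxE mulrC.
apply: le_trans (vnorm_sum _ _ _) _; rewrite mulr_suml ler_sum// => j _.
by rewrite vnormZ mulrC ler_wpM2l ?vnorm_ge0 ?vnorm_coord.
Qed.

Let opset n (A : 'M[CC R]_n) :=
  [set vnorm (A *m v) | v in [set v : 'cV[CC R]_n | vnorm v <= 1]].

Let opset_sup n (A : 'M[CC R]_n) : has_sup (opset A).
Proof.
split; first by exists (vnorm (A *m 0)), 0 => //=; rewrite vnorm0.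
exists (\sum_j vnorm (col j A)) => _ [v /= v1 <-].
apply: le_trans (vnorm_mulmx_bound _ _) _; rewrite ler_piMr// sumr_ge0//.
by move=> j _; exact: vnorm_ge0.
Qed.

Lemma opnorm_ge0 n (A : 'M[CC R]_n) : 0 <= opnorm A.
Proof.
rewrite -(@vnorm0 n) -[X in vnorm X](mulmx0 _ A).
apply: ub_le_sup; first by case: (opset_sup A).
by exists 0 => //=; rewrite vnorm0.
Qed.

Lemma vnorm_mulmx n (A : 'M[CC R]_n) (v : 'cV[CC R]_n) :
  vnorm (A *m v) <= opnorm A * vnorm v.
Proof.
have [v0|v0] := eqVneq (vnorm v) 0.
  by rewrite (vnorm_eq0 v0) mulmx0 vnorm0 mulr0.
have vp : 0 < vnorm v by rewrite lt_def v0 vnorm_ge0.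
have ncV : nc (rC (vnorm v)^-1) = (vnorm v)^-1.
  by rewrite nc_rC ger0_norm// invr_ge0 ltW.
rewrite -ler_pdivrMr// mulrC -ncV -vnormZ scalemxAr.
apply: ub_le_sup; first by case: (opset_sup A).
by exists (rC (vnorm v)^-1 *: v) => //=; rewrite vnormZ ncV mulVf.
Qed.

Lemma opnorm_le n (A : 'M[CC R]_n) c : 0 <= c ->
  (forall v : 'cV[CC R]_n, vnorm (A *m v) <= c * vnorm v) -> opnorm A <= c.
Proof.
move=> c0 Ac; apply: ge_sup; first by case: (opset_sup A).
by move=> _ [v /= v1 <-]; apply: le_trans (Ac v) _; rewrite ler_piMr.
Qed.

Lemma opnorm0 n : opnorm (0 : 'M[CC R]_n) = 0.
Proof.
apply/eqP; rewrite eq_le opnorm_ge0 andbT; apply: opnorm_le => // v.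
by rewrite mul0mx vnorm0 mul0r.
Qed.

Lemma opnorm_le1 n : opnorm (1 : 'M[CC R]_n) <= 1.
Proof. by apply: opnorm_le => // v; rewrite mul1mx mul1r. Qed.

Lemma opnormD n (A B : 'M[CC R]_n) : opnorm (A + B) <= opnorm A + opnorm B.
Proof.
apply: opnorm_le => [|v]; first by rewrite addr_ge0 ?opnorm_ge0.
rewrite mulmxDl mulrDl; apply: le_trans (vnormD _ _) _.
by rewrite lerD ?vnorm_mulmx.
Qed.

Lemma opnorm_sum I (r : seq I) (P : pred I) n (F : I -> 'M[CC R]_n) :
  opnorm (\sum_(i <- r | P i) F i) <= \sum_(i <- r | P i) opnorm (F i).
Proof.
elim/big_ind2: _ => [|z a w c za wc|//]; first by rewrite opnorm0.
exact: le_trans (opnormD _ _) (lerD za wc).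
Qed.

Lemma opnormM n (A B : 'M[CC R]_n) : opnorm (A * B) <= opnorm A * opnorm B.
Proof.
apply: opnorm_le => [|v]; first by rewrite mulr_ge0 ?opnorm_ge0.
rewrite -mulmxA -mulrA; apply: le_trans (vnorm_mulmx _ _) _.
by rewrite ler_wpM2l ?opnorm_ge0 ?vnorm_mulmx.
Qed.

Lemma opnormZ_le n (c : CC R) (A : 'M[CC R]_n) : opnorm (c *: A) <= nc c * opnorm A.
Proof.
apply: opnorm_le => [|v]; first by rewrite mulr_ge0 ?opnorm_ge0 ?nc_ge0.
by rewrite -scalemxAl vnormZ -mulrA ler_wpM2l ?nc_ge0 ?vnorm_mulmx.
Qed.

Lemma opnormN n (A : 'M[CC R]_n) : opnorm (- A) = opnorm A.
Proof.
have le B : opnorm (- B) <= opnorm (B : 'M[CC R]_n).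
  rewrite -scaleN1r; apply: le_trans (opnormZ_le _ _) _.
  by rewrite -(rmorph1 (@rC R)) -rmorphN nc_rC normrN1 mul1r.
have h := le (- A); rewrite opprK in h.
by apply/eqP; rewrite eq_le; apply/andP; split; [exact: le|exact: h].
Qed.

(* The fibres of [k] decompose [C^m] into orthogonal blocks, on each of which
   [M] is a compression of [q]. *)
Lemma opnorm_compress (T : finType) m n (M : 'M[CC R]_m) (q : 'M[CC R]_n)
    (k : 'I_m -> T) (io : 'I_m -> 'I_n) :
  (forall i j, k i = k j -> io i = io j -> i = j) ->
  (forall i j, M i j = if k i == k j then q (io i) (io j) else 0) ->
  opnorm M <= opnorm q.
Proof.
move=> inj ME; apply: opnorm_le => [|v]; first exact: opnorm_ge0.
pose blk t : 'cV[CC R]_n :=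
  \col_a \sum_(j | (k j == t) && (io j == a)) v j ord0.
(* By injectivity at most one index lies over [(t, a)], so the square of the sum is the sum of the
   squares. *)
have blkE t a : \sum_(j | (k j == t) && (io j == a)) nc (v j ord0) ^+ 2 =
                nc (blk t a ord0) ^+ 2.
  rewrite mxE; case: (pickP (fun j => (k j == t) && (io j == a))) => [j Pj|P0].
    have uj i : (k i == t) && (io i == a) = (i == j).
      apply/idP/eqP => [|->//]; case/andP: Pj => /eqP kj /eqP ioj.
      by case/andP => /eqP ki /eqP ioi; apply: inj; rewrite ?ki ?ioi.
    by under eq_bigl do rewrite uj; under [in RHS]eq_bigl do rewrite uj;
       rewrite !big_pred1_eq.
  by rewrite !big_pred0// nc0 expr0n.
have sumE (h : 'I_m -> R) :
    \sum_i h i = \sum_t \sum_a \sum_(j | (k j == t) && (io j == a)) h j.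
  rewrite (partition_big k xpredT)//=; apply: eq_bigr => t _.
  by rewrite (partition_big io xpredT).
have MvE i : (M *m v) i ord0 = (q *m blk (k i)) (io i) ord0.
  rewrite !mxE (bigID (fun j => k j == k i)) /= [X in _ + X]big1 ?addr0; last first.
    by move=> j kj; rewrite ME eq_sym (negbTE kj) mul0r.
  rewrite (partition_big io xpredT)//=; apply: eq_bigr => a _.
  rewrite mxE mulr_sumr; apply: eq_bigr => j /andP[/eqP kj /eqP <-].
  by rewrite ME kj eqxx.
rewrite -(@ler_pXn2r _ 2) ?nnegrE ?mulr_ge0 ?vnorm_ge0 ?opnorm_ge0//.
rewrite exprMn !sqr_vnorm [X in _ <= _ * X]sumE.
under [X in _ <= _ * X]eq_bigr do under eq_bigr do rewrite blkE.
rewrite sumE mulr_sumr; apply: ler_sum => t _.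
apply: (@le_trans _ _ (vnorm (q *m blk t) ^+ 2)); last first.
  rewrite -sqr_vnorm -exprMn ler_pXn2r ?nnegrE ?mulr_ge0 ?vnorm_ge0 ?opnorm_ge0//.
  exact: vnorm_mulmx.
rewrite sqr_vnorm; apply: ler_sum => a _.
case: (pickP (fun j => (k j == t) && (io j == a))) => [j Pj|P0]; last first.
  by rewrite big_pred0// sqr_ge0.
have uj i : (k i == t) && (io i == a) = (i == j).
  apply/idP/eqP => [|->//]; case/andP: Pj => /eqP kj /eqP ioj.
  by case/andP => /eqP ki /eqP ioi; apply: inj; rewrite ?ki ?ioi.
under eq_bigl do rewrite uj.
by rewrite big_pred1_eq MvE; case/andP: Pj => /eqP -> /eqP ->.
Qed.

End OperatorNorm.

(** * Spectral calculus *)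

Section SpectralCalculus.
Variable R : realType.
Implicit Types (m n : nat) (x : R).

Lemma nc_entry_le n (A : 'M[CC R]_n) i j : nc (A i j) <= opnorm A.
Proof.
have -> : A i j = (A *m delta_mx j (ord0 : 'I_1)) i ord0.
  by rewrite -colE mxE.
apply: le_trans (vnorm_coord _ _) _; apply: le_trans (vnorm_mulmx _ _) _.
rewrite ler_piMr ?opnorm_ge0// -(@ler_pXn2r _ 2) ?nnegrE ?vnorm_ge0// expr1n.
rewrite sqr_vnorm (bigD1 j)//= big1 ?addr0 => [|k kj].
  by rewrite mxE !eqxx nc1 expr1n.
by rewrite mxE (negbTE kj) nc0 expr0n.
Qed.

Lemma mx_hausdorff n : hausdorff_space ('M[CC R]_n : topologicalType).
Proof.
move=> p q pq; apply/matrixP => i j; apply/eqP; apply: contraT => neq.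
have hC : hausdorff_space (CC R : topologicalType) by exact: norm_hausdorff.
have := hC; rewrite ball_hausdorff => /(_ _ _ neq)[[r1 r2] /= /eqP r12].
have [M [/= Mp Mq]] : (ball p r1%:num `&` ball q r2%:num)%classic !=set0.
  by apply: pq; exact: nbhsx_ballx.
suff : (ball (p i j) r1%:num `&` ball (q i j) r2%:num)%classic (M i j) by rewrite r12.
by case: Mp => _ Mp; case: Mq => _ Mq; split.
Qed.

(** The limit in [mexp] is taken in the entrywise topology; entries are bounded by [opnorm], and the
    space is Hausdorff, so convergence in norm identifies the limit. *)
Lemma opnorm_lim n (S : nat -> 'M[CC R]_n) (L : 'M[CC R]_n) :
  (forall e : R, 0 < e -> \forall k \near \oo, opnorm (L - S k) < e) ->
  limn S = L.
Proof.
move=> SL; apply: cvg_lim; first exact: mx_hausdorff.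
apply/cvg_ballP => e e0.
(* The radius of a ball over [CC R] is itself complex; being positive, it is real. *)
have eR : e = rC (@complex.Re R e) by apply: rC_real; apply/CrealP; exact: gtr0_real.
have e0' : 0 < @complex.Re R e by rewrite -ltr_rC -eR rmorph0.
apply: filterS (SL _ e0') => k Sk; split => // i j.
rewrite -ball_normE /= -rC_nc eR ltr_rC.
by apply: le_lt_trans Sk; have := nc_entry_le (L - S k) i j; rewrite !mxE.
Qed.

(** * Adjoints and Hermitian matrices *)

Lemma adjE n (A : 'M[CC R]_n) i j : adj A i j = (A j i)^*.
Proof. by rewrite !mxE. Qed.

Lemma adjM n (A B : 'M[CC R]_n) : adj (A * B) = adj B * adj A.
Proof. by rewrite /adj -[A * B]/(A *m B) map_mxM trmx_mul. Qed.

Lemma adjD n (A B : 'M[CC R]_n) : adj (A + B) = adj A + adj B.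
Proof. by apply/matrixP => i j; rewrite !mxE rmorphD. Qed.

Lemma adjN n (A : 'M[CC R]_n) : adj (- A) = - adj A.
Proof. by apply/matrixP => i j; rewrite !mxE rmorphN. Qed.

Lemma adj0 n : adj (0 : 'M[CC R]_n) = 0.
Proof. by apply/matrixP => i j; rewrite !mxE rmorph0. Qed.

Lemma adj1 n : adj (1 : 'M[CC R]_n) = 1.
Proof. by rewrite /adj map_mx1 trmx1. Qed.

Lemma adjZ n x (A : 'M[CC R]_n) : adj (rC x *: A) = rC x *: adj A.
Proof. by apply/matrixP => i j; rewrite !mxE rmorphM /= conj_rC. Qed.

Lemma adjK n (A : 'M[CC R]_n) : adj (adj A) = A.
Proof. by apply/matrixP => i j; rewrite !mxE conjCK. Qed.

Lemma adj_sum I (r : seq I) (p : pred I) n (F : I -> 'M[CC R]_n) :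
  adj (\sum_(i <- r | p i) F i) = \sum_(i <- r | p i) adj (F i).
Proof. exact: (big_morph (@adj R n) (@adjD n) (@adj0 n)). Qed.

Definition herm n (A : 'M[CC R]_n) : Prop := adj A = A.

Lemma herm0 n : herm (0 : 'M[CC R]_n). Proof. exact: adj0. Qed.
Lemma herm1 n : herm (1 : 'M[CC R]_n). Proof. exact: adj1. Qed.
Lemma hermD n (A B : 'M[CC R]_n) : herm A -> herm B -> herm (A + B).
Proof. by move=> hA hB; rewrite /herm adjD hA hB. Qed.
Lemma hermN n (A : 'M[CC R]_n) : herm A -> herm (- A).
Proof. by move=> hA; rewrite /herm adjN hA. Qed.
Lemma hermZ n x (A : 'M[CC R]_n) : herm A -> herm (rC x *: A).
Proof. by move=> hA; rewrite /herm adjZ hA. Qed.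
Lemma hermM n (A B : 'M[CC R]_n) :
  A * B = B * A -> herm A -> herm B -> herm (A * B).
Proof. by move=> AB hA hB; rewrite /herm adjM hA hB. Qed.
Lemma mulmx1_invmx n (A B : 'M[CC R]_n) :
  A * B = 1 -> A \in unitmx /\ invmx A = B.
Proof.
move=> AB; have [uA _] := mulmx1_unit AB; split => //.
by rewrite -[LHS]mulmx1 -[X in _ *m X]AB mulKmx.
Qed.

Lemma invmx_comm n (A B : 'M[CC R]_n) :
  A \in unitmx -> A * B = B * A -> invmx A * B = B * invmx A.
Proof.
move=> uA AB; rewrite -[LHS](mulmxK uA) -[X in X *m invmx A]mulmxA.
by rewrite -[X in invmx A *m X]AB mulKmx.
Qed.

Lemma herm_invmx n (A : 'M[CC R]_n) : A \in unitmx -> herm A -> herm (invmx A).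
Proof.
move=> uA hA.
have /mulmx1_invmx[_] : A * adj (invmx A) = 1.
  by rewrite -{1}hA -adjM -[X in adj X]/(_ *m _) mulVmx// adj1.
by move=> e; rewrite /herm -e.
Qed.

(** Spectral form of a Hermitian matrix. For a fixed unitary [P], [ud P] carries pointwise
    operations on the eigenvalue function [l] to matrix operations, so that matrix statements reduce
    to real ones. *)
Definition ud n (P : 'M[CC R]_n) (l : 'I_n -> R) : 'M[CC R]_n :=
  adj P *m diag_mx (\row_i rC (l i)) *m P.

(** Commuting matrices are triangular in a common unitary basis, and a Hermitian triangular matrix
    is diagonal with real entries. *)
Lemma codiag n (A B : 'M[CC R]_n) : herm A -> herm B -> A * B = B * A ->
  exists P l1 l2, [/\ P *m adj P = 1%:M, A = ud P l1 & B = ud P l2].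
Proof.
move=> hA hB /cotrigonalization2[P Pu /andP[tA tB]].
have adjP : map_mx Num.conj P^T = adj P by apply/matrixP => i j; rewrite !mxE.
have PP : P *m adj P = 1%:M by rewrite -adjP; apply/unitarymxP.
have PP' : adj P *m P = 1%:M by exact: mulmx1C.
have key M : herm M -> is_trig_mx (conjmx P M) ->
    M = ud P (fun i => @complex.Re R ((P *m M *m adj P) i i)).
  move=> hM; rewrite conjymx// adjP => tM.
  set T := P *m M *m adj P in tM *.
  have hT : herm T.
    by rewrite /herm /T !adjM adjK hM; exact: mulrA.
  rewrite /ud; suff -> : diag_mx (\row_i rC (@complex.Re R (T i i))) = T.
    by rewrite /T !mulmxA PP' mul1mx -mulmxA PP' mulmx1.
  apply/matrixP => i j; rewrite [LHS]mxE [X in X *+ _]mxE.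
  case: (ltngtP i j) => [ij|ji|/val_inj <-].
  - rewrite (is_trig_mxP tM i j ij).
    by rewrite -val_eqE /= (ltn_eqF ij) mulr0n.
  - rewrite -[in RHS]hT [RHS]adjE (is_trig_mxP tM j i ji) rmorph0.
    by rewrite -val_eqE /= (gtn_eqF ji) mulr0n.
  - by rewrite eqxx mulr1n -rC_real// -adjE hT.
exists P, (fun i => @complex.Re R ((P *m A *m adj P) i i)),
  (fun i => @complex.Re R ((P *m B *m adj P) i i)).
by split => //; [exact: (key A hA tA)|exact: (key B hB tB)].
Qed.

Lemma hermE n (A : 'M[CC R]_n) : herm A ->
  exists P l, P *m adj P = 1%:M /\ A = ud P l.
Proof. by move=> hA; have [//|P [l [_ [? ? _]]]] := codiag hA hA; exists P, l. Qed.

(** * Calculus in a fixed eigenbasis *)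

Section Unitary.
Variables (n : nat) (P : 'M[CC R]_n).
Hypothesis PP : P *m adj P = 1%:M.
Implicit Types l : 'I_n -> R.

Let PP' : adj P *m P = 1%:M. Proof. exact: mulmx1C. Qed.

Lemma ud_ext l1 l2 : l1 =1 l2 -> ud P l1 = ud P l2.
Proof. by move=> /funext ->. Qed.

Lemma ud_herm l : herm (ud P l).
Proof.
rewrite /herm /ud !adjM adjK [LHS]mulrA.
suff -> : adj (diag_mx (\row_i rC (l i))) = diag_mx (\row_i rC (l i)) :> 'M[CC R]_n by [].
apply/matrixP => i j; rewrite adjE !mxE eq_sym.
by case: eqP => [->|_]; rewrite ?mulr1n ?conj_rC ?mulr0n ?rmorph0.
Qed.

Lemma udD l1 l2 : ud P l1 + ud P l2 = ud P (fun i => l1 i + l2 i).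
Proof.
rewrite /ud -mulmxDl -mulmxDr -linearD; congr (_ *m diag_mx _ *m _).
by apply/rowP => i; rewrite !mxE rmorphD.
Qed.

Lemma udZ x l : rC x *: ud P l = ud P (fun i => x * l i).
Proof.
rewrite /ud scalemxAl scalemxAr -linearZ; congr (_ *m diag_mx _ *m _).
by apply/rowP => i; rewrite !mxE rmorphM.
Qed.

Lemma udN l : - ud P l = ud P (fun i => - l i).
Proof.
rewrite -scaleN1r -(rmorph1 (@rC R)) -rmorphN udZ.
by apply: ud_ext => i; rewrite mulN1r.
Qed.

Lemma ud1 : ud P (fun=> 1) = 1.
Proof.
rewrite /ud; suff -> : diag_mx (\row_i rC ((fun=> 1) i)) = 1%:M :> 'M[CC R]_n.
  by rewrite mulmx1 PP'.
by apply/matrixP => i j; rewrite !mxE rmorph1.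
Qed.

Lemma ud0 : ud P (fun=> 0) = 0.
Proof.
rewrite /ud; suff -> : diag_mx (\row_i rC ((fun=> 0) i)) = 0 :> 'M[CC R]_n.
  by rewrite mulmx0 mul0mx.
by apply/matrixP => i j; rewrite !mxE rmorph0 mul0rn.
Qed.

Lemma udM l1 l2 : ud P l1 * ud P l2 = ud P (fun i => l1 i * l2 i).
Proof.
rewrite -[LHS]/(_ *m _) /ud -!mulmxA; congr (_ *m _).
rewrite [P *m (adj P *m _)]mulmxA PP mul1mx !mulmxA mulmx_diag; congr (diag_mx _ *m _).
by apply/rowP => i; rewrite !mxE rmorphM.
Qed.

Lemma ud_sum I (r : seq I) (p : pred I) (F : I -> 'I_n -> R) :
  \sum_(k <- r | p k) ud P (F k) = ud P (fun i => \sum_(k <- r | p k) F k i).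
Proof.
have -> : (fun i => \sum_(k <- r | p k) F k i) =
    \big[(fun f g i => f i + g i)/fun=> 0]_(k <- r | p k) F k.
  apply/funext => i; elim/big_rec2: _ => //= k y f pk ->; congr (_ + _).
elim/big_rec2: _ => [|k y f pk ->]; first by rewrite ud0.
by rewrite udD.
Qed.

Lemma udX l k : ud P l ^+ k = ud P (fun i => l i ^+ k).
Proof.
elim: k => [|k IH]; first by rewrite expr0 -ud1.
by rewrite exprS IH udM; apply: ud_ext => i; rewrite exprS.
Qed.

Lemma ud_entry l i : (P *m ud P l *m adj P) i i = rC (l i).
Proof.
rewrite /ud !mulmxA PP mul1mx -mulmxA PP mulmx1 !mxE.
by rewrite eqxx mulr1n.
Qed.

Lemma ud_inj l1 l2 : ud P l1 = ud P l2 -> l1 =1 l2.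
Proof. by move=> e i; apply: rC_inj; rewrite -!ud_entry e. Qed.

Lemma sqr_vnormC k (v : 'cV[CC R]_k) :
  rC (vnorm v ^+ 2) = ((map_mx Num.conj v)^T *m v) ord0 ord0.
Proof.
rewrite sqr_vnorm rmorph_sum mxE; apply: eq_bigr => i _.
by rewrite !mxE rmorphXn /= rC_nc normCKC.
Qed.

Lemma unitary_vnorm (v : 'cV[CC R]_n) : vnorm (P *m v) = vnorm v.
Proof.
apply: (@pexpIrn _ 2) => //; rewrite ?nnegrE ?vnorm_ge0//.
apply: rC_inj; rewrite !sqr_vnormC map_mxM trmx_mul.
by rewrite mulmxA -[X in X *m v]mulmxA -/(adj P) PP' mulmx1.
Qed.

End Unitary.

Lemma unitary_opnorm n (P A : 'M[CC R]_n) : P *m adj P = 1%:M ->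
  opnorm (adj P *m A *m P) <= opnorm A.
Proof.
move=> PP; have PP' : adj P *m adj (adj P) = 1%:M by rewrite adjK; exact: mulmx1C.
apply: opnorm_le => [|v]; first exact: opnorm_ge0.
by rewrite -!mulmxA (unitary_vnorm PP') -(unitary_vnorm PP v) vnorm_mulmx.
Qed.

Lemma ud_opnorm n (P : 'M[CC R]_n) l c : P *m adj P = 1%:M -> 0 <= c ->
  (forall i, `|l i| <= c) -> opnorm (ud P l) <= c.
Proof.
move=> PP c0 lc; apply: le_trans (unitary_opnorm _ PP) _.
apply: opnorm_le => // v.
rewrite -(@ler_pXn2r _ 2) ?nnegrE ?mulr_ge0 ?vnorm_ge0// exprMn !sqr_vnorm.
rewrite mulr_sumr; apply: ler_sum => i _.
rewrite mul_diag_mx !mxE ncM exprMn ler_wpM2r ?sqr_ge0//.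
by rewrite ler_pXn2r ?nnegrE ?nc_ge0// nc_rC.
Qed.

Lemma ud_le_opnorm n (P : 'M[CC R]_n) l i : P *m adj P = 1%:M ->
  `|l i| <= opnorm (ud P l).
Proof.
move=> PP; rewrite -nc_rC -(ud_entry PP l i).
apply: le_trans (nc_entry_le _ _ _) _.
have PP' : adj P *m adj (adj P) = 1%:M by rewrite adjK; exact: mulmx1C.
by have := unitary_opnorm (ud P l) PP'; rewrite adjK.
Qed.

End SpectralCalculus.

(** * Exponential and logarithm of Hermitian matrices *)

Section ExpLog.
Variable R : realType.
Implicit Types (m n : nat) (x : R).

Lemma mexp_ud n (P : 'M[CC R]_n) l : P *m adj P = 1%:M ->
  mexp (ud P l) = ud P (fun i => expR (l i)).
Proof.
move=> PP; apply: opnorm_lim => e e0.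
have H : \forall k \near \oo, forall i,
    `|expR (l i) - series (exp_coeff (l i)) k| < e / 2.
  apply: filter_forall => i; have e2 : 0 < e / 2 by rewrite divr_gt0.
  have := is_cvg_series_exp_coeff (l i).
  by move=> /cvgrPdist_lt /(_ _ e2).
apply: filterS H => k Hk.
have -> : series (fun j : nat => (j`!%:R)^-1 *: ud P l ^+ j) k =
          ud P (fun i => series (exp_coeff (l i)) k).
  rewrite /series /= -(ud_sum P); apply: eq_bigr => j _.
  have -> : (j`!%:R : CC R)^-1 = rC (j`!%:R)^-1 by rewrite fmorphV rmorph_nat.
  rewrite (udX PP) (udZ P); apply: ud_ext => i.
  by rewrite /exp_coeff /= mulrC.
rewrite (udN P) (udD P); apply: (@le_lt_trans _ _ (e / 2)).
  by apply: ud_opnorm => // [|i]; [rewrite ltW// divr_gt0|exact/ltW/Hk].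
by rewrite ltr_pdivrMr// mulr_natr mulr2n ltrDl.
Qed.

Lemma mexp_herm n (A : 'M[CC R]_n) : herm A -> herm (mexp A).
Proof. by move=> /hermE[P [l [PP ->]]]; rewrite (mexp_ud _ PP); exact: ud_herm. Qed.

Lemma mexp0 n : mexp (0 : 'M[CC R]_n) = 1.
Proof.
have PP : (1%:M : 'M[CC R]_n) *m adj 1 = 1%:M by rewrite adj1 mulmx1.
rewrite -[X in mexp X](ud0 1) (mexp_ud _ PP) -[RHS](ud1 PP); apply: ud_ext => i.
by rewrite expR0.
Qed.

Lemma mexpD n (A B : 'M[CC R]_n) : herm A -> herm B -> A * B = B * A ->
  mexp (A + B) = mexp A * mexp B.
Proof.
move=> hA hB /(codiag hA hB)[P [l1 [l2 [PP -> ->]]]].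
rewrite (udD P) [LHS](mexp_ud _ PP) [X in X * _](mexp_ud l1 PP) (mexp_ud l2 PP) (udM PP).
apply: ud_ext => i.
by rewrite expRD.
Qed.

Lemma mexpN n (A : 'M[CC R]_n) : herm A -> mexp A * mexp (- A) = 1.
Proof.
by move=> hA; rewrite -mexpD ?subrr ?mexp0//; [exact: hermN|rewrite mulrN mulNr].
Qed.

Lemma opnorm_mexpB1 n (A : 'M[CC R]_n) : herm A ->
  opnorm (mexp A - 1) <= expR (opnorm A) - 1.
Proof.
move=> /hermE[P [l [PP AE]]]; rewrite [in X in X <= _]AE (mexp_ud _ PP) -[X in _ - X](ud1 PP) (udN P) (udD P).
have e1 : 1 <= expR (opnorm A) 
  by apply: le_trans (expR_ge1Dx _); rewrite lerDl opnorm_ge0.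
apply: ud_opnorm => // [|i]; first by rewrite subr_ge0.
have lA : `|l i| <= opnorm A by rewrite AE; exact: ud_le_opnorm.
have h1 : expR (l i) <= expR (opnorm A) by rewrite ler_expR (le_trans (ler_norm _)).
have h2 : expR (- opnorm A) <= expR (l i).
  by rewrite ler_expR lerNl (le_trans (ler_norm _))// normrN.
have ac : expR (opnorm A) * expR (- opnorm A) = 1 by rewrite -expRD subrr expR0.
have c0 := expR_ge0 (- opnorm A).
move: h1 h2 e1 ac c0; set a := expR (opnorm A); set c := expR (- opnorm A).
set u := expR (l i) => h1 h2 e1 ac c0.
(* Nonnegativity of this square is e^x + e^(-x) >= 2 at x = [opnorm A], which turns the lower bound
   e^(-x) - 1 into -(e^x - 1). *)
have cE : c * (a - 1) ^+ 2 = a - 2 + c.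
  have -> : c * (a - 1) ^+ 2 = (a * c) * a - 2 * (a * c) + c by ring.
  by rewrite ac; ring.
have := mulr_ge0 c0 (sqr_ge0 (a - 1)); rewrite cE => c1.
by rewrite ler_norml; apply/andP; split; lra.
Qed.

(** Polynomial functional calculus. Interpolation at the finitely many eigenvalues makes exponential
    and logarithm polynomials in the matrix, so commutation, embeddings, fixed points of partial
    traces and membership in an algebra pass to them without limits. *)
Definition pev n (p : {poly R}) (A : 'M[CC R]_n) : 'M[CC R]_n :=
  \sum_(k < size p) rC p`_k *: A ^+ k.

Lemma pev_ud n (P : 'M[CC R]_n) l p : P *m adj P = 1%:M ->
  pev p (ud P l) = ud P (fun i => p.[l i]).
Proof.
move=> PP; rewrite /pev; under eq_bigr do rewrite (udX PP) (udZ P).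
rewrite (ud_sum P); apply: ud_ext => i.
by rewrite horner_coef.
Qed.

Lemma interpolation (g : R -> R) (s : seq R) :
  exists p : {poly R}, {in s, forall x, p.[x] = g x}.
Proof.
elim: s => [|a s [p ps]]; first by exists 0.
have [as_|as_] := boolP (a \in s).
  by exists p => x; rewrite inE => /orP[/eqP->|/ps//]; exact: ps.
pose q := \prod_(c <- s) ('X - c%:P); have qa : q.[a] != 0.
  by rewrite -rootE root_prod_XsubC.
exists (p + ((g a - p.[a]) / q.[a])%:P * q) => x; rewrite !hornerE inE.
case/orP => [/eqP->|xs]; first by rewrite divfK// addrC subrK.
have /eqP -> : q.[x] == 0 by rewrite -rootE root_prod_XsubC.
by rewrite mulr0 addr0 ps.
Qed.

(** A single polynomial serves two matrices of possibly different sizes; this is what lets the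
    exponential commute with embeddings. *)
Lemma ud_pev (g : R -> R) n (P : 'M[CC R]_n) l m (Q : 'M[CC R]_m) k :
  P *m adj P = 1%:M -> Q *m adj Q = 1%:M ->
  exists p, pev p (ud P l) = ud P (g \o l) /\ pev p (ud Q k) = ud Q (g \o k).
Proof.
move=> PP QQ.
have [p ps] := interpolation g ([seq l i | i <- enum 'I_n] ++ [seq k i | i <- enum 'I_m]).
exists p; rewrite (pev_ud l p PP) (pev_ud k p QQ); split; apply: ud_ext => i /=; rewrite ps// mem_cat.
  by rewrite map_f ?mem_enum.
by rewrite [X in _ || X]map_f ?mem_enum ?orbT.
Qed.

Lemma mexp_pev n (A : 'M[CC R]_n) m (B : 'M[CC R]_m) : herm A -> herm B ->
  exists p, mexp A = pev p A /\ mexp B = pev p B.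
Proof.
move=> /hermE[P [l [PP ->]]] /hermE[Q [k [QQ ->]]].
have [p [p1 p2]] := ud_pev (@expR R) l k PP QQ.
by exists p; rewrite p1 p2 !mexp_ud.
Qed.

(** Interpolating [ln] at the eigenvalues of the exponential recovers the matrix from its
    exponential. *)
Lemma log_pev n (A : 'M[CC R]_n) : herm A -> exists p, A = pev p (mexp A).
Proof.
move=> /hermE[P [l [PP ->]]].
have [p [p1 _]] := ud_pev (@ln R) (fun i => expR (l i)) (fun i => expR (l i)) PP PP.
exists p; rewrite (mexp_ud _ PP) p1; apply: ud_ext => i /=.
by rewrite expRK.
Qed.

Lemma pev_comm n (A B : 'M[CC R]_n) p : A * B = B * A -> pev p A * B = B * pev p A.
Proof.
move=> AB; rewrite /pev mulr_suml mulr_sumr; apply: eq_bigr => k _.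
rewrite -[LHS]scalemxAl -[RHS]scalemxAr; congr (_ *: _).
by rewrite -[LHS]/(A ^+ k * B) -[RHS]/(B * A ^+ k); apply/esym/commrX.
Qed.

Lemma mexp_comm n (A B : 'M[CC R]_n) : herm A -> A * B = B * A ->
  mexp A * B = B * mexp A.
Proof. by move=> hA AB; have [p [-> _]] := mexp_pev hA hA; exact: pev_comm. Qed.

Lemma log_comm n (A B : 'M[CC R]_n) : herm A -> mexp A * B = B * mexp A ->
  A * B = B * A.
Proof. by move=> hA AB; have [p ->] := log_pev hA; exact: pev_comm. Qed.

(** [B] commutes with its own exponential, which is also that of [A], hence with [A]; in a common
    eigenbasis the claim is injectivity of the real exponential. *)
Lemma mexp_inj n (A B : 'M[CC R]_n) : herm A -> herm B -> mexp A = mexp B -> A = B.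
Proof.
move=> hA hB AB; have cAB : A * B = B * A.
  apply: (log_comm hA); rewrite [mexp A]AB; exact: (mexp_comm hB).
have [P [l1 [l2 [PP Al Bl]]]] := codiag hA hB cAB.
move: AB; rewrite Al Bl [LHS](mexp_ud _ PP) (mexp_ud _ PP) => /(ud_inj PP) e.
by apply: ud_ext => i; apply: expR_inj; exact: e.
Qed.

(** [mlog] is a choice among Hermitian logarithms, and injectivity of the exponential leaves only
    one. *)
Lemma mlogE n (A B : 'M[CC R]_n) : herm A -> mexp A = B -> mlog B = A.
Proof.
move=> hA AB.
have [h1 h2] := xgetPex 0 (ex_intro
  [set L : 'M[CC R]_n | adj L = L /\ mexp L = B] A (conj hA AB)).
exact: mexp_inj h1 hA (etrans h2 (esym AB)).
Qed.

Lemma ln_bounds x : 0 < x -> 1 - x^-1 <= ln x <= x - 1.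
Proof.
move=> x0; have ub y : 0 < y -> ln y <= y - 1.
  move=> y0; rewrite -{1}[y](subrK 1) addrC; apply: le_ln1Dx.
  by rewrite ltrBrDr addNr.
rewrite ub// andbT -lerN2 opprB -lnV ?posrE// ub// invr_gt0//.
Qed.

(* The error of the Riemann sum of [x / (1 + t x)] telescopes. *)
Lemma ln1D_riemann x N : (0 < N)%N -> -1 < x ->
  `|ln (1 + x) - \sum_(j < N) N%:R^-1 * (x * (1 + (j%:R / N%:R) * x)^-1)|
    <= N%:R^-1 * (x ^+ 2 / (1 + x)).
Proof.
move=> N0 x1; have NR : 0 < N%:R :> R by rewrite ltr0n.
pose y (j : nat) : R := 1 + j%:R / N%:R * x.
have yp j : (j <= N)%N -> 0 < y j.
  move=> jN; rewrite /y; have t1 : j%:R / N%:R <= 1 :> R.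
    by rewrite ler_pdivrMr// mul1r ler_nat.
  have t0 : 0 <= j%:R / N%:R :> R by rewrite divr_ge0.
  move: t0 t1; set t := (_ / _) => t0 t1.
  have [->|tN0] := eqVneq t 0; first by rewrite mul0r addr0.
  have tx : 0 < t * (1 + x).
    by rewrite mulr_gt0// ?lt_def ?tN0//; move: x1; lra.
  by rewrite mulrDr mulr1 in tx; lra.
have yS j : y j.+1 = y j + N%:R^-1 * x.
  by rewrite /y -natr1 !mulrDl mul1r addrA.
have yN : y N = 1 + x by rewrite /y divff ?gt_eqF// mul1r.
have y0 : y 0 = 1 by rewrite /y !mul0r addr0.
have lnE k : (k <= N)%N -> ln (y k) = \sum_(j < k) ln (y j.+1 / y j).
  elim: k => [|k IH] kN; first by rewrite y0 ln1 big_ord0.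
  rewrite big_ord_recr /= -IH ?(ltnW kN)// lnM ?posrE ?yp// ?invr_gt0 ?yp ?(ltnW kN)//.
  by rewrite lnV ?posrE ?yp ?(ltnW kN)// addrC subrK.
rewrite -yN lnE// -sumrB.
(* For u = y_(j+1) / y_j, the upper bound u - 1 on ln u is exactly the j-th Riemann term, and the
   lower bound 1 - 1/u is the same term with y_(j+1) in place of y_j. *)
have step (j : 'I_N) :
    - (N%:R^-1 * x * ((y j)^-1 - (y j.+1)^-1)) <=
    ln (y j.+1 / y j) - N%:R^-1 * (x * (1 + (j%:R / N%:R) * x)^-1) <= 0.
  have p0 := yp j (ltnW (ltn_ord j)); have p1 := yp j.+1 (ltn_ord j).
  have /andP[lo hi] := ln_bounds (divr_gt0 p1 p0).
  rewrite -/(y j) subr_le0 lerBrDr; apply/andP; split.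
    apply: le_trans lo; rewrite invf_div yS.
    have p1' : y j * N%:R + x = N%:R * y j.+1.
      by rewrite yS mulrDr mulrA mulfV ?gt_eqF// mul1r mulrC.
    rewrite le_eqVlt; apply/orP; left; apply/eqP; field.
    by rewrite p1' mulf_neq0 ?gt_eqF.
  apply: le_trans hi _; rewrite yS le_eqVlt; apply/orP; left; apply/eqP; field.
  by rewrite !gt_eqF.
rewrite ler_norml; apply/andP; split; last first.
  apply: (@le_trans _ _ (\sum_(j < N) (0 : R))).
    by apply: ler_sum => j _; have /andP[] := step j.
  rewrite big1//; apply: mulr_ge0; first by rewrite invr_ge0 ltW.
  by rewrite divr_ge0 ?sqr_ge0// ltW// yp.
apply: (@le_trans _ _ (\sum_(j < N) - (N%:R^-1 * x * ((y j)^-1 - (y j.+1)^-1)))).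
  rewrite sumrN -mulr_sumr lerN2.
  have -> : \sum_(j < N) ((y j)^-1 - (y j.+1)^-1) = 1 - (y N)^-1.
    rewrite -(big_mkord xpredT (fun j => (y j)^-1 - (y j.+1)^-1)).
    rewrite -(opprK (\sum_(0 <= j < N) _)) -sumrN.
    under eq_bigr do rewrite opprB.
    by rewrite telescope_sumr// y0 invr1 opprB.
  rewrite [in X in X <= _]yN [in X in _ <= X]yN le_eqVlt; apply/orP; left; apply/eqP; field.
  by rewrite -yN !gt_eqF// yp.
by apply: ler_sum => j _; have /andP[] := step j.
Qed.

(** The spectrum of [r] lies in [-eps, eps], so all claims are scalar. The logarithm is described by
    Riemann sums because their terms are products of [r] with inverses, which the weighted norm can
    estimate. *)
Lemma log1D n (r : 'M[CC R]_n) eps : herm r -> opnorm r <= eps -> eps < 1 ->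
  (forall t, 0 <= t <= 1 -> 1 + rC t *: r \in unitmx) /\
  exists A, [/\ herm A, mexp A = 1 + r & forall N, (0 < N)%N ->
    opnorm (A - \sum_(j < N) rC N%:R^-1 *: (r * invmx (1 + rC (j%:R / N%:R) *: r)))
      <= N%:R^-1 * (1 - eps)^-1].
Proof.
move=> /hermE[P [l [PP ->]]] re e1.
have le i : `|l i| <= eps by apply: le_trans re; exact: ud_le_opnorm.
have ltE i : - eps <= l i <= eps by have := le i; rewrite ler_norml.
have tE t : 1 + rC t *: ud P l = ud P (fun i => 1 + t * l i).
  by rewrite -[X in X + _](ud1 PP) (udZ P) (udD P).
have tP t i : 0 <= t <= 1 -> 0 < 1 + t * l i.
  move=> /andP[t0 t1]; have /andP[l0 _] := ltE i.
  have eps0 : 0 <= eps by exact: le_trans (le i).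
  have h1 : t * (l i + eps) >= 0 by rewrite mulr_ge0//; lra.
  have h2 : (1 - t) * eps >= 0 by rewrite mulr_ge0//; lra.
  by lra.
have inv t : 0 <= t <= 1 -> (1 + rC t *: ud P l \in unitmx) /\
    invmx (1 + rC t *: ud P l) = ud P (fun i => (1 + t * l i)^-1).
  move=> t01; apply: mulmx1_invmx; rewrite tE (udM PP) -[RHS](ud1 PP).
  by apply: ud_ext => i; rewrite mulfV// gt_eqF// tP.
split=> [t /inv[]//|].
have lp i : 0 < 1 + l i by have := @tP 1 i; rewrite mul1r; apply; rewrite ler01 lexx.
exists (ud P (fun i => ln (1 + l i))); split.
- exact: ud_herm.
- rewrite (mexp_ud _ PP) -[X in X + _](ud1 PP) (udD P); apply: ud_ext => i.
  by rewrite lnK// posrE.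
move=> N N0; have NR : 0 < N%:R :> R by rewrite ltr0n.
have -> : \sum_(j < N) rC N%:R^-1 *: (ud P l * invmx (1 + rC (j%:R / N%:R) *: ud P l))
    = ud P (fun i => \sum_(j < N) N%:R^-1 * (l i * (1 + (j%:R / N%:R) * l i)^-1)).
  rewrite -(ud_sum P); apply: eq_bigr => j _.
  have jN : 0 <= (j%:R / N%:R : R) <= 1.
    by rewrite divr_ge0//= ler_pdivrMr// mul1r ler_nat ltnW.
  by have [_ ->] := inv _ jN; rewrite (udM PP) (udZ P).
rewrite (udN P) (udD P); apply: ud_opnorm => // [|i].
  by rewrite mulr_ge0 ?invr_ge0 ?ltW// subr_gt0.
have l1 : -1 < l i by have := lp i; lra.
apply: le_trans (ln1D_riemann N0 l1) _.
rewrite ler_wpM2l ?invr_ge0 ?(ltW NR)// -[X in _ <= X]mul1r.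
have /andP[l2 l3] := ltE i.
apply: ler_pM; rewrite ?sqr_ge0 ?invr_ge0 ?(ltW (lp i))//.
  by rewrite -[leRHS](expr1n _ 2) -ler_sqrt ?ltr01// sqrtr_sqr expr1n sqrtr1 (le_trans (le i))// ltW.
by rewrite lef_pV2 ?posrE ?subr_gt0//; lra.
Qed.

End ExpLog.

(** * Union-convolution algebra of set functions *)

Section Moebius.
Variables (K : choiceType) (M : zmodType).
Implicit Types (B C U : {fset K}) (F : {fset K} -> M).

Lemma big_fpowersetE B U F : B `<=` U ->
  \sum_(C <- fpowerset B) F C = \sum_(C <- fpowerset U | C `<=` B) F C.
Proof.
move=> BU; rewrite -[RHS]big_filter; apply: perm_big; apply: uniq_perm.
- exact: fset_uniq.
- by rewrite filter_uniq// fset_uniq.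
move=> C; rewrite mem_filter !fpowersetE; case: (boolP (C `<=` B)) => //= CB.
by rewrite (fsubset_trans CB BU).
Qed.

(* [mob] inverts summation over subsets; [mobn] computes it recursively, the
   fuel [k] being irrelevant as soon as it reaches the cardinal of the set. *)
Fixpoint mobn (k : nat) F B : M :=
  F B - (if k is k'.+1 then \sum_(C <- fpowerset B | C != B) mobn k' F C else 0).

Definition mob F B := mobn #|` B| F B.

Lemma mobn_irrelevant k k' F B : (#|` B| <= k)%N -> (#|` B| <= k')%N ->
  mobn k F B = mobn k' F B.
Proof.
have empty F' : \sum_(C <- fpowerset fset0 | C != fset0 :> {fset K}) F' C = 0 :> M.
  rewrite big_seq_cond big1// => C.
  by rewrite fpowersetE fsubset0 => /andP[/eqP->]; rewrite eqxx.
elim: k k' B => [|k IH] [|k'] B //=.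
- by rewrite leqn0 cardfs_eq0 => /eqP -> _; rewrite empty.
- by rewrite leqn0 cardfs_eq0 => _ /eqP ->; rewrite empty.
move=> Bk Bk'; congr (_ - _); rewrite big_seq_cond [RHS]big_seq_cond.
apply: eq_bigr => C /andP[]; rewrite fpowersetE => CB CnB.
have cC : (#|` C| < #|` B|)%N by apply: fproper_ltn_card; rewrite fproperEneq CnB.
by apply: IH; rewrite -ltnS (leq_trans cC).
Qed.

Lemma sum_mob F B : \sum_(C <- fpowerset B) mob F C = F B.
Proof.
rewrite (bigD1_seq B) ?fset_uniq ?fpowersetE ?fsubset_refl//=.
rewrite /mob -(@mobn_irrelevant #|` B|.+1)//=.
suff -> : \sum_(C <- fpowerset B | C != B) mobn #|` B| F C =
          \sum_(C <- fpowerset B | C != B) mobn #|` C| F C by rewrite subrK.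
rewrite big_seq_cond [RHS]big_seq_cond; apply: eq_bigr => C /andP[].
by rewrite fpowersetE => CB _; apply: mobn_irrelevant; rewrite ?fsubset_leq_card.
Qed.

(** The way to compute [mob]: exhibit coefficients whose subset sums give [F]. Working below [U]
    allows [F] to be known only there. *)
Lemma mob_unique U F (c : {fset K} -> M) :
  (forall B, B `<=` U -> F B = \sum_(C <- fpowerset B) c C) ->
  forall B, B `<=` U -> mob F B = c B.
Proof.
move=> Fc B; have [k] := ubnP #|` B|; elim: k B => // k IH B Bk BU.
have := sum_mob F B; rewrite Fc//.
rewrite (bigD1_seq B) ?fset_uniq ?fpowersetE ?fsubset_refl//=.
rewrite [in RHS](bigD1_seq B) ?fset_uniq ?fpowersetE ?fsubset_refl//=.
suff -> : \sum_(C <- fpowerset B | C != B) mob F C =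
          \sum_(C <- fpowerset B | C != B) c C by move/addIr.
rewrite big_seq_cond [RHS]big_seq_cond.
apply: eq_bigr => C /andP[]; rewrite fpowersetE => CB CnB.
have cC : (#|` C| < #|` B|)%N by apply: fproper_ltn_card; rewrite fproperEneq CnB.
by apply: IH; [rewrite (leq_trans cC)|exact: fsubset_trans BU].
Qed.

Lemma mob_ext U F G : (forall B, B `<=` U -> F B = G B) ->
  forall B, B `<=` U -> mob F B = mob G B.
Proof.
by move=> FG; apply: mob_unique => B BU; rewrite FG// sum_mob.
Qed.

Lemma mobD F G B : mob (fun C => F C + G C) B = mob F B + mob G B.
Proof.
apply: (@mob_unique B _ (fun C => mob F C + mob G C)) => // C _.
by rewrite big_split /= !sum_mob.
Qed.

Lemma mob_cst a B : mob (fun=> a) B = if B == fset0 then a else 0.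
Proof.
apply: (@mob_unique B _ (fun C => if C == fset0 then a else 0)) => // C _.
rewrite (bigD1_seq fset0) ?fset_uniq ?fpowersetE ?fsub0set//=.
by rewrite big1 ?addr0 ?eqxx// => D /negbTE ->.
Qed.

(** A function that ignores [Y] expands in sets avoiding [Y]: the candidate coefficients are those
    of [F], put to zero on sets containing [Y]. *)
Lemma mob_pinned F Y B : Y \in B -> mob (fun C => F (C `\ Y)) B = 0.
Proof.
move=> YB; pose c C := if Y \in C then 0 else mob F C.
rewrite (@mob_unique B _ c) ?/c ?YB// => C _.
rewrite -(sum_mob F) (big_fpowersetE _ (fsubD1set C Y)).
rewrite big_mkcond /=; apply: eq_big_seq => D; rewrite fpowersetE => DC.
by rewrite fsubsetD1 DC /=; case: (Y \in D).
Qed.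

End Moebius.

Lemma mob_morph (K : choiceType) (M M' : zmodType) (h : M -> M')
    (F : {fset K} -> M) B : (forall a c, h (a + c) = h a + h c) -> h 0 = 0 ->
  h (mob F B) = mob (fun C => h (F C)) B.
Proof.
move=> hD h0; apply/esym; apply: (@mob_unique _ _ B _ (fun C => h (mob F C))) => // C _.
by rewrite -(big_morph h hD h0) sum_mob.
Qed.

(** * Weighted norm of set functions *)

Section WeightedNorm.
Variables (R : realType) (K : choiceType) (M : pzRingType) (N : M -> R).
Hypotheses (N_ge0 : forall a, 0 <= N a) (N0 : N 0 = 0) (NN : forall a, N (- a) = N a)
  (ND : forall a c, N (a + c) <= N a + N c) (NM : forall a c, N (a * c) <= N a * N c)
  (N1 : N 1 <= 1).
Variables (U : {fset K}) (w : {fset K} -> R).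
Hypotheses (w_ge1 : forall B, 1 <= w B) (w0 : w fset0 = 1)
  (wU : forall B C, w (B `|` C) <= w B * w C).
Implicit Types (B C : {fset K}) (F G : {fset K} -> M).

Let w_ge0 B : 0 <= w B. Proof. exact: le_trans (w_ge1 B). Qed.

Let N_sum I (r : seq I) (P : pred I) (f : I -> M) :
  N (\sum_(i <- r | P i) f i) <= \sum_(i <- r | P i) N (f i).
Proof.
elim/big_ind2: _ => [|z a v c za vc|//]; first by rewrite N0.
exact: le_trans (ND _ _) (lerD za vc).
Qed.

Definition wnorm F : R := \sum_(B <- fpowerset U) w B * N (mob F B).

Lemma wnorm_ge0 F : 0 <= wnorm F.
Proof. by apply: sumr_ge0 => B _; rewrite mulr_ge0. Qed.

Lemma wnorm_ext F G : (forall B, B `<=` U -> F B = G B) -> wnorm F = wnorm G.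
Proof.
move=> FG; apply: eq_big_seq => B; rewrite fpowersetE => BU.
by rewrite (mob_ext FG).
Qed.

Lemma wnormD F G : wnorm (fun B => F B + G B) <= wnorm F + wnorm G.
Proof.
rewrite /wnorm -big_split; apply: ler_sum => B _ /=.
by rewrite mobD -mulrDr ler_wpM2l.
Qed.

Lemma wnorm_cst a : wnorm (fun=> a) = N a.
Proof.
rewrite /wnorm (bigD1_seq fset0) ?fset_uniq ?fpowersetE ?fsub0set//=.
rewrite mob_cst eqxx w0 mul1r big1 ?addr0// => B /negbTE B0.
by rewrite mob_cst B0 N0 mulr0.
Qed.

Lemma wnorm_sum I (r : seq I) (P : pred I) (f : I -> {fset K} -> M) :
  wnorm (fun B => \sum_(i <- r | P i) f i B) <= \sum_(i <- r | P i) wnorm (f i).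
Proof.
elim: r => [|i r IH].
  rewrite (@wnorm_ext _ (fun=> 0)) => [|B _]; last by rewrite big_nil.
  by rewrite wnorm_cst N0 big_nil.
rewrite (@wnorm_ext _ (fun B => (if P i then f i B else 0) +
    \sum_(i <- r | P i) f i B)) => [|B _]; last first.
  by rewrite big_cons; case: ifP; rewrite ?add0r.
rewrite big_cons; case: (P i).
  by apply: le_trans (wnormD _ _) _; rewrite lerD2l.
apply: le_trans (wnormD _ _) _; rewrite wnorm_cst N0 add0r; exact: IH.
Qed.

Lemma le_wnorm F B : B `<=` U -> N (F B) <= wnorm F.
Proof.
move=> BU; rewrite -(sum_mob F); apply: le_trans (N_sum _ _ _) _.
rewrite (big_fpowersetE _ BU) big_mkcond; apply: ler_sum => C _.
case: ifP => _; last by rewrite mulr_ge0.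
by rewrite ler_peMl.
Qed.

Let big_sel (A : zmodType) (P : pred {fset K}) D (x : A) : D `<=` U ->
  \sum_(B <- fpowerset U | P B && (D == B)) x = if P D then x else 0.
Proof.
move=> DU; rewrite big_mkcond (bigD1_seq D) ?fset_uniq ?fpowersetE//= eqxx andbT.
by rewrite big1 ?addr0// => B /negbTE; rewrite eq_sym => ->; rewrite andbF.
Qed.

(** In the product of the two expansions at [B], a pair [(C, D)] occurs exactly when the union of
    [C] and [D] lies in [B]; grouping the pairs by their union exhibits the coefficients. *)
Lemma mobM F G B : B `<=` U -> mob (fun C => F C * G C) B =
  \sum_(C <- fpowerset U) \sum_(D <- fpowerset U | C `|` D == B) mob F C * mob G D.
Proof.
move: B; apply: mob_unique => B BU.
rewrite -(sum_mob F) -(sum_mob G) !(big_fpowersetE _ BU) exchange_big /=.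
rewrite mulr_suml big_mkcond; apply: eq_big_seq => C; rewrite fpowersetE => CU.
rewrite (exchange_big_dep xpredT) //=.
transitivity (\sum_(D <- fpowerset U) if C `|` D `<=` B then mob F C * mob G D else 0).
  case: ifP => CB.
    rewrite mulr_sumr big_mkcond; apply: eq_bigr => D _.
    by rewrite fsubUset CB.
  by rewrite big1// => D _; rewrite fsubUset CB.
apply: eq_big_seq => D; rewrite fpowersetE => DU.
by rewrite (big_sel (fun B' => B' `<=` B)) // fsubUset CU.
Qed.

Lemma wnormM F G : wnorm (fun B => F B * G B) <= wnorm F * wnorm G.
Proof.
apply: (@le_trans _ _ (\sum_(B <- fpowerset U) \sum_(C <- fpowerset U)
    \sum_(D <- fpowerset U | C `|` D == B) w B * (N (mob F C) * N (mob G D)))).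
  rewrite /wnorm !big_seq; apply: ler_sum => B; rewrite fpowersetE => BU.
  rewrite mobM//; apply: (@le_trans _ _ (w B * (\sum_(C <- fpowerset U)
      \sum_(D <- fpowerset U | C `|` D == B) N (mob F C) * N (mob G D)))).
    rewrite ler_wpM2l//; apply: le_trans (N_sum _ _ _) _; apply: ler_sum => C _.
    apply: le_trans (N_sum _ _ _) _; apply: ler_sum => D _; exact: NM.
  rewrite mulr_sumr; apply: ler_sum => C _; by rewrite mulr_sumr.
rewrite exchange_big /= /wnorm mulr_suml !big_seq.
apply: ler_sum => C; rewrite fpowersetE => CU.
rewrite (exchange_big_dep xpredT)//= mulr_sumr !big_seq.
apply: ler_sum => D; rewrite fpowersetE => DU.
rewrite (eq_bigr (fun=> w (C `|` D) * (N (mob F C) * N (mob G D)))) => [|B /eqP <-//].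
rewrite (big_sel xpredT) ?fsubUset ?CU// mulrACA.
by rewrite ler_wpM2r ?mulr_ge0.
Qed.

(** The indicator switches a ratio on when [X] is present. Its only possible nonzero coefficient
    below [U] is 1, at [[fset X]], so the switch costs one weight. *)
Lemma wnorm_in X : wnorm (fun B => if X \in B then 1 else 0) <= w [fset X].
Proof.
have mobE B : B `<=` U -> mob (fun B => if X \in B then 1 else 0 : M) B =
    if B == [fset X] then 1 else 0.
  move: B; apply: mob_unique => B BU.
  have [XB|XB] := boolP (X \in B).
    rewrite (bigD1_seq [fset X]) ?fset_uniq ?fpowersetE ?fsub1set//=.
    by rewrite eqxx big1 ?addr0// => C /negbTE ->.
  rewrite big1_seq// => C; rewrite fpowersetE => /andP[_ CB].
  by case: eqP => // CX; move: CB; rewrite CX fsub1set (negbTE XB).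
rewrite /wnorm; have [XU|XU] := boolP (X \in U).
  rewrite (bigD1_seq [fset X]) ?fset_uniq ?fpowersetE ?fsub1set//= big1_seq ?addr0.
    by rewrite mobE ?fsub1set// eqxx ler_piMr.
  by move=> B; rewrite fpowersetE => /andP[/negbTE BX BU]; rewrite mobE// BX N0 mulr0.
rewrite big1_seq// => B; rewrite fpowersetE => /andP[_ BU].
rewrite mobE//; case: eqP => [BX|_]; last by rewrite N0 mulr0.
by move: XU; rewrite -fsub1set -BX BU.
Qed.

(** From G = 1 - r G follows |G| <= 1 + eps |G|. As |G| is a finite sum, this can be solved for it
    without a Neumann series. *)
Lemma wnorm_inv r G eps : wnorm r <= eps -> eps < 1 ->
  (forall B, B `<=` U -> (1 + r B) * G B = 1) -> wnorm G <= (1 - eps)^-1.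
Proof.
move=> re e1 rG.
have GE B : B `<=` U -> G B = 1 + - 1 * (r B * G B).
  by move=> /rG; rewrite mulrDl mul1r mulN1r => <-; rewrite addrK.
have : wnorm G <= 1 + eps * wnorm G.
  rewrite {1}(wnorm_ext GE); apply: le_trans (wnormD _ _) _.
  rewrite wnorm_cst lerD//; apply: le_trans (wnormM _ _) _.
  rewrite wnorm_cst NN; apply: (@le_trans _ _ (1 * (wnorm r * wnorm G))).
    by apply: ler_pM => //; [exact: wnorm_ge0|exact: wnormM].
  by rewrite mul1r ler_wpM2r// wnorm_ge0.
rewrite -subr_ge0 => h; rewrite -[leRHS]mul1r ler_pdivlMr ?subr_gt0//.
by rewrite -subr_ge0 (le_trans h)// le_eqVlt; apply/orP; left; apply/eqP; ring.
Qed.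

(** Only the existence of a constant independent of [F] matters: it makes the remainder of a Riemann
    sum negligible in the weighted norm. *)
Lemma mob_bound B : exists2 c, 0 <= c & forall F delta,
  (forall C, C `<=` B -> N (F C) <= delta) -> N (mob F B) <= c * delta.
Proof.
have [k] := ubnP #|` B|; elim: k B => // k IH B Bk.
(* The induction hypothesis is made total in [C], with constant 0 away from proper subsets, so that
   [choice] can collect the constants. *)
have {}IH C : exists c, 0 <= c /\ (C `<=` B -> C != B -> forall F delta,
    (forall D, D `<=` C -> N (F D) <= delta) -> N (mob F C) <= c * delta).
  have [/andP[CB CnB]|nCB] := boolP ((C `<=` B) && (C != B)); last first.
    by exists 0; split=> // CB CnB; rewrite CB CnB in nCB.
  have [|c c0 Hc] := IH C; last by exists c.
  have cC : (#|` C| < #|` B|)%N by apply: fproper_ltn_card; rewrite fproperEneq CnB.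
  by rewrite (leq_trans cC).
have [c Hc] := choice IH.
exists (1 + \sum_(C <- fpowerset B | C != B) c C).
  by rewrite addr_ge0// sumr_ge0// => C _; have [] := Hc C.
move=> F delta FB.
have -> : mob F B = F B + - \sum_(C <- fpowerset B | C != B) mob F C.
  rewrite -(sum_mob F B) (bigD1_seq B) ?fset_uniq ?fpowersetE ?fsubset_refl//=.
  by rewrite addrK.
apply: le_trans (ND _ _) _; rewrite NN mulrDl mul1r lerD ?FB ?fsubset_refl//.
apply: le_trans (N_sum _ _ _) _; rewrite mulr_suml big_seq_cond [leRHS]big_seq_cond.
apply: ler_sum => C /andP[]; rewrite fpowersetE => CB CnB.
have [_ /(_ CB CnB)] := Hc C; apply => D DC; apply: FB; exact: fsubset_trans CB.
Qed.

Lemma wnorm_bound : exists2 c, 0 <= c & forall F delta,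
  (forall C, C `<=` U -> N (F C) <= delta) -> wnorm F <= c * delta.
Proof.
have H B : exists c, 0 <= c /\ forall F delta,
    (forall C, C `<=` B -> N (F C) <= delta) -> N (mob F B) <= c * delta.
  by have [c ? ?] := mob_bound B; exists c.
have [c Hc] := choice H.
exists (\sum_(B <- fpowerset U) w B * c B).
  by apply: sumr_ge0 => B _; rewrite mulr_ge0//; have [] := Hc B.
move=> F delta FU; rewrite mulr_suml /wnorm !big_seq.
apply: ler_sum => B; rewrite fpowersetE => BU; rewrite -mulrA ler_wpM2l//.
by have [_] := Hc B; apply => C CB; apply: FU; exact: fsubset_trans BU.
Qed.

(** [M] is a mere ring, so the scalars 1/k and j/k enter as elements [a] and [c j], and [G j] is the
    inverse of 1 + (j/k) r. Each of the k terms has norm at most (1/k) eps / (1 - eps); the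
    remainder, bounded in [N], vanishes as k grows. *)
Lemma wnorm_log r L eps : wnorm r <= eps -> eps < 1 ->
  (forall k, (0 < k)%N -> exists (a : M) (c : 'I_k -> M) (G : 'I_k -> {fset K} -> M),
    [/\ N a <= k%:R^-1, forall j, N (c j) <= 1,
        forall j B, B `<=` U -> (1 + c j * r B) * G j B = 1 &
        forall B, B `<=` U ->
          N (L B - \sum_(j < k) a * (r B * G j B)) <= k%:R^-1 * (1 - eps)^-1]) ->
  wnorm L <= eps / (1 - eps).
Proof.
move=> re e1 H; have eps0 : 0 <= eps by apply: le_trans re; exact: wnorm_ge0.
have e10 : 0 < 1 - eps by rewrite subr_gt0.
have [c c0 Hc] := wnorm_bound.
apply/ler_addgt0Pr => e ep.
(* Large enough that the remainder, at most c / (k (1 - eps)), does not exceed [e]; [c] was fixed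
   before [k]. *)
pose k := (Num.bound (c * (1 - eps)^-1 / e)).+1.
have k0 : (0 < k)%N by []; have kR : 0 < k%:R :> R by rewrite ltr0n.
have [a [d [G [Na Nd dG LG]]]] := H k k0.
rewrite (@wnorm_ext _ (fun B => \sum_(j < k) a * (r B * G j B) +
   (L B - \sum_(j < k) a * (r B * G j B)))) => [|B _]; last by rewrite addrC subrK.
apply: le_trans (wnormD _ _) _; apply: lerD; last first.
  apply: le_trans (Hc _ _ LG) _; rewrite mulrCA mulrC ler_pdivrMr//.
  rewrite -ler_pdivrMl// mulrC ltW//; apply: lt_le_trans (archi_boundP _) _.
    by rewrite !mulr_ge0// ?invr_ge0 ltW.
  by rewrite ler_nat.
apply: le_trans (wnorm_sum _ _ _) _.
apply: (@le_trans _ _ (\sum_(j < k) k%:R^-1 * (eps / (1 - eps)))); last first.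
  by rewrite sumr_const card_ord -[leLHS]mulr_natl mulrA mulfV ?mul1r// gt_eqF.
apply: ler_sum => j _; apply: le_trans (wnormM _ _) _; rewrite wnorm_cst.
apply: ler_pM => //; first exact: wnorm_ge0.
apply: le_trans (wnormM _ _) _; apply: ler_pM => //; try exact: wnorm_ge0.
apply: (@wnorm_inv (fun B => d j * r B)) => //; last exact: dG.
apply: le_trans (wnormM _ _) _; rewrite wnorm_cst -[leRHS]mul1r.
by apply: ler_pM => //; exact: wnorm_ge0.
Qed.

End WeightedNorm.

(** * Partial traces and embeddings *)

Section Averages.
Variable F : numFieldType.

Definition avg (T : finType) (h : T -> F) : F := (#|T|%:R)^-1 * \sum_t h t.

Lemma eq_avg (T : finType) (h h' : T -> F) : h =1 h' -> avg h = avg h'.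
Proof. by move=> /funext ->. Qed.

Lemma avg_cst (T : finType) (a : F) : (0 < #|T|)%N -> avg (fun _ : T => a) = a.
Proof.
move=> T0; rewrite /avg sumr_const -[X in _ * X]mulr_natl mulKf//.
by rewrite pnatr_eq0 -lt0n.
Qed.

Lemma avg_sum (T S : finType) (P : pred S) (h : S -> T -> F) :
  avg (fun t => \sum_(x | P x) h x t) = \sum_(x | P x) avg (h x).
Proof. by rewrite /avg exchange_big mulr_sumr. Qed.

Lemma avgMl (T : finType) (a : F) (h : T -> F) : avg (fun t => a * h t) = a * avg h.
Proof. by rewrite /avg -mulr_sumr mulrCA. Qed.

Lemma avg_pair (S T : finType) (h : S -> T -> F) :
  avg (fun s => avg (h s)) = avg (fun u : S * T => h u.1 u.2).
Proof.
by rewrite /avg -mulr_sumr pair_bigA /= card_prod natrM invfM mulrA.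
Qed.

(* Exchanging [p r] with an independent uniform [v] is an involution of [T * T'],
   so [p] maps the uniform distribution to the uniform distribution. *)
Lemma avg_pushforward (T T' : finType) (p : T -> T') (q : T -> T' -> T) (h : T' -> F) :
  (0 < #|T|)%N -> (0 < #|T'|)%N ->
  (forall r v, p (q r v) = v) -> (forall r v, q (q r v) (p r) = r) ->
  avg (fun r => h (p r)) = avg h.
Proof.
move=> T0 T'0 pq qp; pose phi (u : T * T') := (q u.1 u.2, p u.1).
have phiK : involutive phi by case=> r v; rewrite /phi /= qp pq.
transitivity (avg (fun r : T => avg (fun v : T' => h (p r)))).
  by apply: eq_avg => r; rewrite avg_cst.
transitivity (avg (fun r : T => avg (fun v : T' => h v))); last by rewrite avg_cst.
rewrite !avg_pair /avg (reindex_inj (inv_inj phiK)) /=; congr (_ * _).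
by apply: eq_bigr => -[r v] _; rewrite pq.
Qed.

End Averages.

(** * Partial traces as uniform averages *)

Section PartialTrace.
Variables (R : realType) (V : choiceType) (D : nat).
Hypothesis D0 : (0 < D)%N.
Local Notation conf := (conf D).
Local Notation Op := (Op R D).
Implicit Types (X Y Lam : {fset V}) (L : set V).

Lemma opent_mk X (f : conf X -> conf X -> CC R) s t : opent (mkOp f) s t = f s t.
Proof. by rewrite /opent mxE !enum_rankK. Qed.

Lemma Op_ext X (Q P : Op X) : (forall s t, opent Q s t = opent P s t) -> Q = P.
Proof.
move=> QP; apply/matrixP => i j.
by have := QP (enum_val i) (enum_val j); rewrite /opent !enum_valK.
Qed.

Lemma opentD X (Q P : Op X) s t : opent (Q + P) s t = opent Q s t + opent P s t.
Proof. by rewrite /opent mxE. Qed.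

Lemma opentZ X c (Q : Op X) s t : opent (c *: Q) s t = c * opent Q s t.
Proof. by rewrite /opent mxE. Qed.

Lemma opent1 X (s t : conf X) : opent (1 : Op X) s t = (s == t)%:R.
Proof. by rewrite /opent -[1]/(1%:M) mxE (inj_eq enum_rank_inj). Qed.

Lemma opent_adj X (Q : Op X) s t : opent (adj Q) s t = (opent Q t s)^*.
Proof. by rewrite /opent adjE. Qed.

Lemma opentM X (Q P : Op X) s t :
  opent (Q * P) s t = \sum_u opent Q s u * opent P u t.
Proof.
rewrite /opent -[Q * P]/(Q *m P) mxE (reindex (@enum_rank _))//=.
by exists enum_val => i _; rewrite ?enum_rankK ?enum_valK.
Qed.

Lemma card_conf_gt0 X : (0 < #|{: conf X}|)%N.
Proof. by apply/card_gt0P; exists [ffun=> Ordinal D0]. Qed.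

Definition offeq Lam L (s t : conf Lam) : bool :=
  [forall x : Lam, ~~ `[< L (val x) >] ==> (s x == t x)].

Lemma offeqP Lam L (s t : conf Lam) :
  reflect (forall x : Lam, ~ L (val x) -> s x = t x) (offeq L s t).
Proof.
apply: (iffP forallP) => H x; have := H x.
  by move=> /implyP h Lx; apply/eqP/h/asboolP.
by move=> h; apply/implyP => /asboolP /h ->.
Qed.

Lemma cglue_in Lam L (r t : conf Lam) x : L (val x) -> cglue L r t x = t x.
Proof. by move=> /asboolT h; rewrite ffunE h. Qed.

Lemma cglue_out Lam L (r t : conf Lam) x : ~ L (val x) -> cglue L r t x = r x.
Proof. by move=> /asboolF h; rewrite ffunE h. Qed.

Lemma conf_eqP Lam L (s t : conf Lam) : (forall x, L (val x) -> s x = t x) ->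
  (forall x, ~ L (val x) -> s x = t x) -> s = t.
Proof.
move=> h1 h2; apply/ffunP => x.
by have [Lx|Lx] := pselect (L (val x)); [exact: h1|exact: h2].
Qed.

Lemma cglueK Lam L (r r' t : conf Lam) : cglue L r (cglue L r' t) = cglue L r t.
Proof.
apply: (@conf_eqP _ L) => x Lx; first by rewrite !cglue_in.
by rewrite !cglue_out.
Qed.

Lemma cglueKl Lam L (r s t : conf Lam) : cglue L (cglue L r s) t = cglue L r t.
Proof.
apply: (@conf_eqP _ L) => x Lx; first by rewrite !cglue_in.
by rewrite !cglue_out.
Qed.

Lemma cglue_id Lam L (s t : conf Lam) : offeq L s t -> cglue L s t = t.
Proof.
move=> /offeqP st; apply: (@conf_eqP _ L) => x Lx; first by rewrite cglue_in.
by rewrite cglue_out// st.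
Qed.

Lemma offeq_cglue Lam L (r s t : conf Lam) : offeq L (cglue L r s) t = offeq L r t.
Proof.
by apply/offeqP/offeqP => H x Lx; have := H x Lx; rewrite cglue_out.
Qed.

Lemma offeqxx Lam L (s : conf Lam) : offeq L s s.
Proof. exact/offeqP. Qed.

Lemma card_cglue_fiber Lam L (r s : conf Lam) :
  [forall x : Lam, `[< L (val x) >] ==> (r x == s x)] ->
  #|[pred r' | cglue L r' s == r]| = (D ^ #|[pred x : Lam | `[< L (val x) >]]|)%N.
Proof.
move=> /forallP rs.
pose Fm (x : Lam) := if `[< L (val x) >] then predT else pred1 (r x).
have -> : #|[pred r' | cglue L r' s == r]| = #|family Fm|.
  apply: eq_card => r'; rewrite !inE; apply/eqP/familyP => [e x|H].
    rewrite /Fm; case: ifP => // /asboolP Lx.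
    by rewrite inE -e cglue_out.
  apply/ffunP => x; have := H x; rewrite /Fm ffunE; case: ifP => Lx.
    by move=> _; have := rs x; rewrite Lx => /eqP.
  by move=> /eqP.
rewrite card_family foldrE big_map big_enum /=.
transitivity (\prod_(x : Lam) (if `[< L (val x) >] then D else 1)%N).
  by apply: eq_bigr => x _; rewrite /Fm; case: ifP => _; rewrite ?card_ord ?card1.
by rewrite -big_mkcond /= prod_nat_const.
Qed.

(** The sum over configurations frozen on [L] becomes an average over all configurations,
    overwritten on [L]: each frozen configuration is hit D^(number of sites in L) times. Partial
    traces can then be handled as expectations. *)
Lemma opent_econd L Lam (Q : Op Lam) s t : opent (econd L Q) s t =
  if offeq L s t then avg (fun r => opent Q (cglue L r s) (cglue L r t)) else 0.
Proof.
rewrite opent_mk -/(offeq L s t); case: ifP => // st.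
pose P (r : conf Lam) := [forall x : Lam, `[< L (val x) >] ==> (r x == s x)].
rewrite /avg [in RHS](partition_big (fun r' => cglue L r' s) P) /=; last first.
  move=> r' _; apply/forallP => x; apply/implyP => /asboolP Lx.
  by rewrite cglue_in.
transitivity ((#|{: conf Lam}|%:R)^-1 * \sum_(r | P r)
    ((D ^ #|[pred x : Lam | `[< L (val x) >]]|)%:R * opent Q r (cglue L r t) : CC R)).
  rewrite -mulr_sumr mulrA; congr (_ * _).
  have DC : (D%:R : CC R) != 0 by rewrite pnatr_eq0 -lt0n.
  rewrite card_ffun card_ord -(cardC [pred x : Lam | `[< L (val x) >]]).
  rewrite expnD natrM invfM mulrAC mulVf ?mul1r ?natrX//.
  by rewrite expf_neq0.
congr (_ * _); apply: eq_bigr => r Pr.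
rewrite -(card_cglue_fiber Pr) mulr_natl -sumr_const.
apply: eq_big => [r'|r']; rewrite inE// => /eqP <-.
by rewrite cglueKl.
Qed.

Lemma econdD L Lam (Q P : Op Lam) : econd L (Q + P) = econd L Q + econd L P.
Proof.
apply: Op_ext => s t; rewrite opentD !opent_econd; case: ifP => _; last by rewrite addr0.
rewrite /avg -mulrDr -big_split; congr (_ * _); apply: eq_bigr => r _.
exact: opentD.
Qed.

Lemma econdZ L Lam c (Q : Op Lam) : econd L (c *: Q) = c *: econd L Q.
Proof.
apply: Op_ext => s t; rewrite opentZ !opent_econd; case: ifP => _; last by rewrite mulr0.
by rewrite -avgMl; apply: eq_avg => r; rewrite opentZ.
Qed.

Lemma econd1 L Lam : econd L (1 : Op Lam) = 1.
Proof.
apply: Op_ext => s t; rewrite opent1 opent_econd; case: ifP => st; last first.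
  by case: eqP st => // ->; rewrite offeqxx.
rewrite -[RHS](avg_cst _ (card_conf_gt0 Lam)); apply: eq_avg => r; rewrite opent1.
congr ((_ : bool)%:R); apply/eqP/eqP => [e|->//].
apply: (@conf_eqP _ L) => x Lx; last exact: (offeqP _ _ _ st).
by rewrite -(cglue_in r s Lx) e cglue_in.
Qed.

Lemma econd_adj L Lam (Q : Op Lam) : econd L (adj Q) = adj (econd L Q).
Proof.
apply: Op_ext => s t; rewrite opent_adj !opent_econd.
have -> : offeq L t s = offeq L s t by apply/offeqP/offeqP => H x /H.
case: ifP => _; last by rewrite rmorph0.
rewrite /avg rmorphM fmorphV rmorph_nat rmorph_sum; congr (_ * _).
by apply: eq_bigr => r _; rewrite opent_adj.
Qed.

(** The two averages run over independent uniform configurations, and gluing two of these along [L']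
    gives again a uniform one. *)
Lemma econd_comp L L' Lam (Q : Op Lam) :
  econd L (econd L' Q) = econd (L `&` L')%classic Q.
Proof.
apply: Op_ext => s t; rewrite !opent_econd.
under eq_avg do rewrite opent_econd.
have offI r : offeq L s t ->
    offeq L' (cglue L r s) (cglue L r t) = offeq (L `&` L')%classic s t.
  move=> /offeqP st; apply/offeqP/offeqP => H x.
    have [Lx|Lx _] := pselect (L (val x)); last exact: st.
    by move=> LL'; have := H x; rewrite !cglue_in//; apply => L'x; exact: LL'.
  have [Lx L'x|Lx _] := pselect (L (val x)); last by rewrite !cglue_out.
  by rewrite !cglue_in//; apply: H => -[].
have [st|st] := boolP (offeq L s t); last first.
  case: ifP => // /offeqP H; move: st.
  by case/offeqP => x Lx; apply: H => -[].
under eq_avg do rewrite offI//.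
case: ifP => _; last by rewrite avg_cst ?card_conf_gt0.
rewrite avg_pair.
pose p (u : conf Lam * conf Lam) := cglue L' u.2 u.1.
pose q (u : conf Lam * conf Lam) v := (cglue L' u.1 v, cglue L' v u.2).
pose h v := opent Q (cglue (L `&` L')%classic v s) (cglue (L `&` L')%classic v t).
rewrite -/(avg h) -(@avg_pushforward _ _ _ p q h).
- apply: eq_avg => -[r r'] /=; rewrite /h /p /=.
  suff gE u : cglue L' r' (cglue L r u) =
              cglue (L `&` L')%classic (cglue L' r' r) u by rewrite !gE.
  apply: (@conf_eqP _ (L `&` L')%classic) => x LL'.
    by rewrite [RHS]cglue_in//; case: LL' => Lx L'x; rewrite !cglue_in.
  rewrite [RHS]cglue_out//; have [L'x|L'x] := pselect (L' (val x)).
    by rewrite !(cglue_in _ _ L'x) cglue_out// => Lx; exact: LL'.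
  by rewrite !(cglue_out _ _ L'x).
- by rewrite card_prod muln_gt0 !card_conf_gt0.
- exact: card_conf_gt0.
- move=> [r r'] v; rewrite /p /q /=; apply: (@conf_eqP _ L') => x Lx.
    by rewrite !cglue_in.
  by rewrite !cglue_out.
- move=> [r r'] v; rewrite /p /q /=.
  congr pair; apply: (@conf_eqP _ L') => x Lx; rewrite ?(cglue_in _ _ Lx) ?(cglue_out _ _ Lx)//.
Qed.

(** Module property of conditional expectations: entries of [econd L Q] vanish unless the parts off
    [L] agree, and do not depend on that common part, so they leave the average. *)
Lemma econdMl L Lam (Q P : Op Lam) :
  econd L (econd L Q * P) = econd L Q * econd L P.
Proof.
apply: Op_ext => s t; rewrite opent_econd opentM.
pose a u := avg (fun r' => opent Q (cglue L r' s) (cglue L r' u)).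
have aE u r : a (cglue L r u) = a u by apply: eq_avg => r'; rewrite cglueK.
have [st|st] := boolP (offeq L s t); last first.
  rewrite big1// => u _; rewrite !opent_econd.
  case: ifP => su; last by rewrite mul0r.
  case: ifP => ut; last by rewrite mulr0.
  case/negP: st; apply/offeqP => x Lx.
  by rewrite (offeqP _ _ _ su)// (offeqP _ _ _ ut).
transitivity (avg (fun r => \sum_(v | offeq L s v) a v * opent P (cglue L r v) (cglue L r t))).
  apply: eq_avg => r; rewrite opentM.
  transitivity (\sum_(u | offeq L r u) a u * opent P u (cglue L r t)).
    rewrite [RHS]big_mkcond; apply: eq_bigr => u _; rewrite opent_econd offeq_cglue.
    case: ifP => _; last by rewrite mul0r.
    by congr (_ * _); apply: eq_avg => r'; rewrite cglueK.
  rewrite (reindex_onto (cglue L r) (cglue L s)) /=; last first.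
    by move=> u ru; rewrite cglueK cglue_id.
  apply: eq_big => [v|v _]; last by rewrite aE.
  have -> : offeq L r (cglue L r v) by apply/offeqP => x Lx; rewrite cglue_out.
  rewrite /= cglueK; apply/eqP/idP => [<-|/cglue_id//].
  by apply/offeqP => x Lx; rewrite cglue_out.
rewrite avg_sum [LHS]big_mkcond; apply: eq_bigr => v _.
rewrite [in RHS]opent_econd; case: ifP => sv; last by rewrite mul0r.
rewrite avgMl; congr (_ * _); rewrite opent_econd.
suff -> : offeq L v t by [].
by apply/offeqP => x Lx; rewrite -(offeqP _ _ _ sv)// (offeqP _ _ _ st).
Qed.

Lemma econdMr L Lam (Q P : Op Lam) :
  econd L (P * econd L Q) = econd L P * econd L Q.
Proof.
rewrite -[LHS]adjK -econd_adj [X in econd L X]adjM -[X in econd L (X * _)]econd_adj.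
by rewrite econdMl adjM !econd_adj !adjK.
Qed.

Lemma econd_ext L L' Lam (Q : Op Lam) : (forall x : Lam, L (val x) <-> L' (val x)) ->
  econd L Q = econd L' Q.
Proof.
move=> LL'; apply: Op_ext => s t; rewrite !opent_econd.
have -> : offeq L s t = offeq L' s t.
  by apply/offeqP/offeqP => H x Lx; apply: H => /LL'.
case: ifP => // _; apply: eq_avg => r.
have gE u : cglue L r u = cglue L' r u.
  apply/ffunP => x; have [Lx|Lx] := pselect (L (val x)).
    by rewrite !cglue_in//; exact/LL'.
  by rewrite !cglue_out// => /LL'.
by rewrite !gE.
Qed.

(** The conditional expectation is the mean over [r] of matrices [M r] that are block diagonal in
    the part off [L], each block being the compression of [Q] to configurations equal to [r] off
    [L]. *)
Lemma opnorm_econd L Lam (Q : Op Lam) : opnorm (econd L Q) <= opnorm Q.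
Proof.
pose M r : Op Lam := mkOp (fun s t : conf Lam =>
  if offeq L s t then opent Q (cglue L r s) (cglue L r t) else 0).
have -> : econd L Q = \sum_r rC (#|{: conf Lam}|%:R)^-1 *: M r.
  apply: Op_ext => s t; rewrite opent_econd [RHS]/opent summxE.
  transitivity (avg (fun r => opent (M r) s t)).
    case: ifP => st; last by under eq_avg do rewrite opent_mk st;
      rewrite avg_cst ?card_conf_gt0.
    by apply: eq_avg => r; rewrite opent_mk st.
  rewrite /avg mulr_sumr; apply: eq_bigr => r _.
  by rewrite mxE fmorphV rmorph_nat.
have MQ r : opnorm (M r) <= opnorm Q.
  apply: (@opnorm_compress _ {: conf Lam} _ _ _ _
    (fun i => cglue L (enum_val i) r) (fun i => enum_rank (cglue L r (enum_val i)))).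
    move=> i j kk /enum_rank_inj io; apply: enum_val_inj.
    apply: (@conf_eqP _ L) => x Lx; first by rewrite -(cglue_in r _ Lx) io cglue_in.
    by rewrite -(cglue_out (enum_val i) r Lx) kk cglue_out.
  move=> i j; rewrite mxE; have -> // : offeq L (enum_val i) (enum_val j) =
      (cglue L (enum_val i) r == cglue L (enum_val j) r).
  apply/offeqP/eqP => [H|kk x Lx].
    apply: (@conf_eqP _ L) => x Lx; first by rewrite !cglue_in.
    by rewrite !cglue_out// H.
  by rewrite -(cglue_out (enum_val i) r Lx) kk cglue_out.
apply: le_trans (opnorm_sum _ _ _) _.
apply: (@le_trans _ _ (\sum_(r : conf Lam) (#|{: conf Lam}|%:R)^-1 * opnorm Q)).
  apply: ler_sum => r _; apply: le_trans (opnormZ_le _ _) _.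
  have c0 : 0 <= (#|{: conf Lam}|%:R)^-1 :> R by rewrite invr_ge0 ler0n.
  by rewrite nc_rC (ger0_norm c0); apply: ler_wpM2l; [exact: c0|exact: MQ].
rewrite sumr_const -[leLHS]mulr_natl mulrA mulfV ?mul1r//.
by rewrite pnatr_eq0 -lt0n card_conf_gt0.
Qed.

End PartialTrace.

(** * Embeddings of local algebras *)

Section Embedding.
Variables (R : realType) (V : choiceType) (D : nat).
Hypothesis D0 : (0 < D)%N.
Local Notation conf := (conf D).
Local Notation Op := (Op R D).
Implicit Types (X Y Lam : {fset V}) (L : set V).

Let fs X : set V := [set x | x \in X].

Lemma opent_emb X Y (h : X `<=` Y) (Q : Op X) s t : opent (emb Y Q) s t =
  if offeq (fs X) s t then opent Q (restr h s) (restr h t) else 0.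
Proof.
have -> : emb Y Q = embP h Q.
  rewrite /emb; move: (erefl _); rewrite {2 3}h => h'.
  by congr embP; exact: bool_irrelevance.
rewrite opent_mk; congr (if _ then _ else _).
by apply: eq_forallb => y; congr (~~ _ ==> _); rewrite asboolb.
Qed.

Definition extc X Y (r : conf Y) (v : conf X) : conf Y :=
  [ffun y : Y => if insub (val y) is Some x then v x else r y].

Lemma extc_in X Y (r : conf Y) (v : conf X) (y : Y) (x : X) :
  val y = val x -> extc r v y = v x.
Proof. by move=> yx; rewrite ffunE yx valK. Qed.

Lemma extc_out X Y (r : conf Y) (v : conf X) (y : Y) :
  val y \notin X -> extc r v y = r y.
Proof. by move=> yX; rewrite ffunE insubN. Qed.

Lemma restrE X Y (h : X `<=` Y) (s : conf Y) (y : Y) (x : X) :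
  val y = val x -> restr h s x = s y.
Proof. by move=> yx; rewrite ffunE; congr (s _); apply: val_inj; rewrite yx. Qed.

Lemma restr_extc X Y (h : X `<=` Y) (r : conf Y) (v : conf X) : restr h (extc r v) = v.
Proof. by apply/ffunP => x; rewrite ffunE; exact: extc_in. Qed.

Lemma extc_restr X Y (h : X `<=` Y) (r s : conf Y) :
  extc r (restr h s) = cglue (fs X) r s.
Proof.
apply: (@conf_eqP _ _ _ (fs X)) => y yX.
  by rewrite cglue_in// (@extc_in _ _ _ _ _ [` yX])// (restrE _ _ (y := y)).
by rewrite cglue_out// extc_out//; apply/negP.
Qed.

Lemma restr_cglue X Y (h : X `<=` Y) L (r s : conf Y) :
  restr h (cglue L r s) = cglue L (restr h r) (restr h s).
Proof. by apply/ffunP => x; rewrite !ffunE. Qed.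

Lemma restr_eqE X Y (h : X `<=` Y) (s t : conf Y) :
  restr h s = restr h t -> forall y : Y, val y \in X -> s y = t y.
Proof.
move=> e y yX; have := congr1 (fun u : conf X => u [` yX]) e.
by rewrite !(restrE _ _ (y := y)).
Qed.

Lemma embD X Y (Q P : Op X) : X `<=` Y -> emb Y (Q + P) = emb Y Q + emb Y P.
Proof.
move=> h; apply: Op_ext => s t; rewrite opentD !(opent_emb h).
by case: ifP => _; rewrite ?opentD ?addr0.
Qed.

Lemma embZ X Y c (Q : Op X) : X `<=` Y -> emb Y (c *: Q) = c *: emb Y Q.
Proof.
move=> h; apply: Op_ext => s t; rewrite opentZ !(opent_emb h).
by case: ifP => _; rewrite ?opentZ ?mulr0.
Qed.

Lemma emb0 X Y : X `<=` Y -> emb Y (0 : Op X) = 0.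
Proof. by move=> h; rewrite -(scale0r (0 : Op X)) (embZ _ _ h) scale0r. Qed.

Lemma emb1 X Y : X `<=` Y -> emb Y (1 : Op X) = 1.
Proof.
move=> h; apply: Op_ext => s t; rewrite (opent_emb h) !opent1.
case: ifP => [/offeqP st|st]; last by case: eqP st => // ->; rewrite offeqxx.
congr ((_ : bool)%:R); apply/eqP/eqP => [e|->//].
apply: (@conf_eqP _ _ _ (fs X)) => // y yX.
exact: restr_eqE e _ yX.
Qed.

Lemma emb_adj X Y (Q : Op X) : X `<=` Y -> emb Y (adj Q) = adj (emb Y Q).
Proof.
move=> h; apply: Op_ext => s t; rewrite opent_adj !(opent_emb h).
have -> : offeq (fs X) t s = offeq (fs X) s t by apply/offeqP/offeqP => H x /H.
by case: ifP => _; rewrite ?opent_adj ?rmorph0.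
Qed.

Lemma embM X Y (Q P : Op X) : X `<=` Y -> emb Y (Q * P) = emb Y Q * emb Y P.
Proof.
move=> h; apply: Op_ext => s t; rewrite opentM (opent_emb h).
have [st|st] := boolP (offeq (fs X) s t); last first.
  rewrite big1// => u _; rewrite !(opent_emb h).
  case: ifP => su; last by rewrite mul0r.
  case: ifP => ut; last by rewrite mulr0.
  case/negP: st; apply/offeqP => x Lx.
  by rewrite (offeqP _ _ _ su)// (offeqP _ _ _ ut).
rewrite opentM [RHS](bigID (offeq (fs X) s)) /= [X in _ + X]big1 ?addr0; last first.
  by move=> u su; rewrite (opent_emb h) (negbTE su) mul0r.
rewrite [RHS](reindex_onto (extc s) (restr h)) /=; last first.
  by move=> u su; rewrite extc_restr cglue_id.
apply: eq_big => [v|v _].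
  rewrite restr_extc eqxx andbT; apply/esym/offeqP => y yX.
  by rewrite extc_out//; apply/negP.
rewrite !(opent_emb h) restr_extc.
have e1 : offeq (fs X) s (extc s v).
  by apply/offeqP => y yX; rewrite extc_out//; apply/negP.
have e2 : offeq (fs X) (extc s v) t.
  apply/offeqP => y yX; rewrite extc_out; first exact: (offeqP _ _ _ st).
  exact/negP.
by rewrite e1 e2.
Qed.

Lemma emb_trans X Y Lam (Q : Op X) : X `<=` Y -> Y `<=` Lam ->
  emb Lam (emb Y Q) = emb Lam Q.
Proof.
move=> h h'; have h'' := fsubset_trans h h'.
apply: Op_ext => s t; rewrite (opent_emb h') (opent_emb h'') (opent_emb h).
have rr u : restr h (restr h' u) = restr h'' u.
  by apply/ffunP => x; rewrite !ffunE; congr (u _); exact: val_inj.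
rewrite !rr; case: (boolP (offeq (fs X) s t)) => [/offeqP st|st].
  have -> : offeq (fs Y) s t.
    by apply/offeqP => y yY; apply: st => yX; apply: yY; exact: (fsubsetP h).
  suff -> : offeq (fs X) (restr h' s) (restr h' t) by [].
  by apply/offeqP => y yX; rewrite !ffunE; exact: st.
case: ifP => // /offeqP st1; case: ifP => // /offeqP st2.
case/negP: st; apply/offeqP => y yX.
have [yY|yY] := boolP (val y \in Y); last by apply: st1; apply/negP.
have := st2 [` yY] yX; rewrite !(restrE h' _ (y := y))//.
Qed.

(** The restriction to [X] of a uniform configuration on [Y] is uniform, so averaging over the
    additional sites changes nothing. *)
Lemma econd_emb X Y L (Q : Op X) : X `<=` Y -> econd L (emb Y Q) = emb Y (econd L Q).
Proof.
move=> h; apply: Op_ext => s t; rewrite (opent_econd D0) (opent_emb h) (opent_econd D0).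
have p1 : avg (fun r : conf Y => opent Q (cglue L (restr h r) (restr h s))
                                   (cglue L (restr h r) (restr h t))) =
          avg (fun r : conf X => opent Q (cglue L r (restr h s)) (cglue L r (restr h t))).
  pose hh (r : conf X) := opent Q (cglue L r (restr h s)) (cglue L r (restr h t)).
  rewrite -[RHS]/(avg hh) -(@avg_pushforward _ _ _ (restr h) (@extc X Y) hh)//.
  - exact: card_conf_gt0.
  - exact: card_conf_gt0.
  - by move=> r v; rewrite restr_extc.
  - move=> r v; rewrite extc_restr; apply: (@conf_eqP _ _ _ (fs X)) => y yX.
      by rewrite cglue_in.
    by rewrite cglue_out// extc_out//; apply/negP.
have [/offeqP stX|stX] := boolP (offeq (fs X) s t); last first.
  case: ifP => // /offeqP st.
  rewrite (eq_avg (h' := fun=> 0)) ?avg_cst ?card_conf_gt0// => r.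
  rewrite (opent_emb h); case: ifP => // /offeqP H; case/negP: stX.
  apply/offeqP => y yX; have := H y yX.
  have [Ly|Ly] := pselect (L (val y)); first by rewrite !cglue_in.
  by move=> _; exact: st.
have offE : offeq L (restr h s) (restr h t) = offeq L s t.
  apply/offeqP/offeqP => H y Ly; last by rewrite !ffunE; exact: H.
  have [yX|yX] := boolP (val y \in X); last by apply: stX; exact/negP.
  by have := H [` yX] Ly; rewrite !(restrE h _ (y := y)).
rewrite offE; case: ifP => // _; rewrite -p1; apply: eq_avg => r.
rewrite (opent_emb h) !restr_cglue.
suff -> : offeq (fs X) (cglue L r s) (cglue L r t) by [].
apply/offeqP => y yX.
have [Ly|Ly] := pselect (L (val y)); first by rewrite !cglue_in// stX.
by rewrite !cglue_out.
Qed.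

Lemma econd_id X (Q : Op X) : econd (fs X) Q = Q.
Proof.
apply: Op_ext => s t; rewrite (opent_econd D0).
have st : offeq (fs X) s t by apply/offeqP => x; case; exact: (valP x).
rewrite st -[RHS](avg_cst _ (card_conf_gt0 D0 X)); apply: eq_avg => r.
have gE u : cglue (fs X) r u = u by apply/ffunP => x; rewrite cglue_in// /fs /= (valP x).
by rewrite !gE.
Qed.

Lemma econd_supp X Y (Q : Op X) : X `<=` Y -> econd (fs X) (emb Y Q) = emb Y Q.
Proof. by move=> h; rewrite (econd_emb _ _ h) econd_id. Qed.

Lemma supported_econd X L (Q : Op X) : econd L Q = Q -> supported_in (fsetIs X L) Q.
Proof.
move=> EQ; have h : fsetIs X L `<=` X by apply/fsubsetP => x; rewrite !inE => /andP[].
pose r0 : conf X := [ffun=> Ordinal D0].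
(* The entries are read off with the sites outside [L] frozen at [r0]; invariance under [econd L]
   makes them independent of this choice. *)
exists (mkOp (fun s t => opent Q (extc r0 s) (extc r0 t))).
apply: Op_ext => s t; rewrite (opent_emb h) opent_mk !extc_restr.
have LE (x : X) : fs (fsetIs X L) (val x) <-> L (val x).
  rewrite /fs /= !inE (valP x) /=; split; [exact: asboolW|exact: asboolT].
have -> : offeq (fs (fsetIs X L)) s t = offeq L s t.
  by apply/offeqP/offeqP => H x Lx; apply: H => /LE.
have gE u : cglue (fs (fsetIs X L)) r0 u = cglue L r0 u.
  apply/ffunP => x; have [Lx|Lx] := pselect (L (val x)).
    by rewrite !cglue_in//; exact/LE.
  by rewrite !cglue_out// => /LE.
rewrite !gE -EQ !(opent_econd D0) offeq_cglue.
have -> : offeq L r0 (cglue L r0 t) by apply/offeqP => x Lx; rewrite cglue_out.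
by case: ifP => // _; apply: eq_avg => r; rewrite !cglueK.
Qed.

Lemma opnorm_emb_le X Y (Q : Op X) : X `<=` Y -> opnorm (emb Y Q) <= opnorm Q.
Proof.
(* Blocks are labelled by the configuration outside [X]; [None] masks the sites of [X]. *)
move=> h; pose k (i : 'I_#|{: conf Y}|) : {ffun Y -> option 'I_D} :=
  [ffun y => if val y \in X then None else Some (enum_val i y)].
apply: (@opnorm_compress _ _ _ _ _ _ k (fun i => enum_rank (restr h (enum_val i)))).
  move=> i j kk /enum_rank_inj io; apply: enum_val_inj; apply/ffunP => y.
  have [yX|yX] := boolP (val y \in X); first exact: restr_eqE io _ yX.
  have := congr1 (fun u : {ffun Y -> option 'I_D} => u y) kk.
  by rewrite !ffunE (negbTE yX) => -[].
move=> i j; have := opent_emb h Q (enum_val i) (enum_val j).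
rewrite {1}/opent !enum_valK => ->; rewrite /opent.
suff -> : offeq (fs X) (enum_val i) (enum_val j) = (k i == k j) by [].
apply/offeqP/eqP => [H|kk y yX].
  by apply/ffunP => y; rewrite !ffunE; case: ifP => // yX; rewrite H// /fs /= yX.
have := congr1 (fun u : {ffun Y -> option 'I_D} => u y) kk.
by rewrite !ffunE (negbTE (introN idP yX)) => -[].
Qed.

(** [Q] is the block of its embedding at one frozen outer configuration. This moves norms of
    effective terms into a common large volume. *)
Lemma le_opnorm_emb X Y (Q : Op X) : X `<=` Y -> opnorm Q <= opnorm (emb Y Q).
Proof.
move=> h; pose r0 : conf Y := [ffun=> Ordinal D0].
apply: (@opnorm_compress _ unit _ _ _ _ (fun=> tt)
  (fun i => enum_rank (extc r0 (enum_val i)))).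
  move=> i j _ /enum_rank_inj e; apply: enum_val_inj.
  by rewrite -(restr_extc h r0 (enum_val i)) e restr_extc.
move=> i j; rewrite eqxx -/(opent (emb Y Q) _ _) (opent_emb h) !restr_extc.
have -> : offeq (fs X) (extc r0 (enum_val i)) (extc r0 (enum_val j)).
  by apply/offeqP => y /negP yX; rewrite !extc_out.
by rewrite /opent !enum_valK.
Qed.

Lemma emb_sum X Y I (r : seq I) (p : pred I) (F : I -> Op X) : X `<=` Y ->
  emb Y (\sum_(i <- r | p i) F i) = \sum_(i <- r | p i) emb Y (F i).
Proof.
move=> h; apply: (big_morph (@emb R V D X Y)) => [Q P|]; first exact: embD.
exact: emb0.
Qed.

Lemma emb_pev X Y (Q : Op X) p : X `<=` Y -> emb Y (pev p Q) = pev p (emb Y Q).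
Proof.
move=> h; rewrite /pev (emb_sum _ _ _ h); apply: eq_bigr => k _.
rewrite (embZ _ _ h); congr (_ *: _); elim: (k : nat) => [|m IH].
  by rewrite !expr0 (emb1 h).
by rewrite !exprS (embM _ _ h) IH.
Qed.

Lemma emb_herm X Y (Q : Op X) : X `<=` Y -> herm Q -> herm (emb Y Q).
Proof. by move=> h hQ; rewrite /herm -(emb_adj _ h) hQ. Qed.

Lemma emb_mexp X Y (Q : Op X) : X `<=` Y -> herm Q -> emb Y (mexp Q) = mexp (emb Y Q).
Proof.
move=> h hQ; have [p [-> ->]] := mexp_pev hQ (emb_herm h hQ).
exact: emb_pev.
Qed.

End Embedding.

(** * Cluster estimate *)

Section Cluster.
Variables (R : realType) (V : choiceType) (n : nat).
Local Notation M := 'M[CC R]_n.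
Implicit Types (X Y W : {fset V}) (A B : {fset {fset V}}) (Q P : M).

(* The norm is a variable so that unification never unfolds [opnorm]. *)
Variable N : M -> R.
Hypothesis NE : N = @opnorm R n.

Let N_ge0 a : 0 <= N a. Proof. by rewrite NE opnorm_ge0. Qed.
Let N0 : N 0 = 0. Proof. by rewrite NE opnorm0. Qed.
Let NN a : N (- a) = N a. Proof. by rewrite NE opnormN. Qed.
Let ND a c : N (a + c) <= N a + N c. Proof. by rewrite NE opnormD. Qed.
Let NM a c : N (a * c) <= N a * N c. Proof. by rewrite NE opnormM. Qed.
Let N1 : N 1 <= 1. Proof. by rewrite NE opnorm_le1. Qed.

(** Abstract form of the spin system: [E] is the conditional expectation, [Alg] the commutative
    algebra, [Sup Y] the operators supported in [Y], [e A] the Boltzmann factor of the family [A],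
    and [1 + f X] that of a single set. *)
Variables (E : M -> M) (Alg : set M) (Sup : {fset V} -> set M).
Variables (U : {fset {fset V}}) (f : {fset V} -> M) (e : {fset {fset V}} -> M).
Variables (w : {fset {fset V}} -> R) (d : nat) (eps : R).
Hypotheses (w_ge1 : forall B, 1 <= w B) (w0 : w fset0 = 1)
  (wU : forall B C, w (B `|` C) <= w B * w C).
Hypotheses (E_add : forall Q P, E (Q + P) = E Q + E P) (E1 : E 1 = 1)
  (E_le : forall Q, N (E Q) <= N Q) (E_herm : forall Q, herm Q -> herm (E Q))
  (E_fact : forall Y W Q P, Sup Y Q -> Sup W P -> Y `&` W = fset0 ->
     E (Q * P) = E Q * E P).
Hypotheses (Sup1 : forall Y, Sup Y 1)
  (SupD : forall Y Q P, Sup Y Q -> Sup Y P -> Sup Y (Q + P))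
  (SupM : forall Y W Q P, Sup Y Q -> Sup W P -> Sup (Y `|` W) (Q * P))
  (Sup_f : forall X, X \in U -> Sup X (f X)).
Hypotheses (Alg1 : Alg 1) (AlgD : forall Q P, Alg Q -> Alg P -> Alg (Q + P))
  (AlgM : forall Q P, Alg Q -> Alg P -> Alg (Q * P))
  (AlgC : forall Q P, Alg Q -> Alg P -> Q * P = P * Q)
  (AlgE : forall Q, Alg Q -> Alg (E Q))
  (Alg_f : forall X, X \in U -> Alg (f X)) (herm_f : forall X, X \in U -> herm (f X)).
Hypotheses (e0 : e fset0 = 1)
  (eD1 : forall A X, A `<=` U -> X \in A -> e A = e (A `\ X) * (1 + f X)).
Hypothesis U0 : fset0 \notin U.

Definition meets Y A : nat := #|` [fset X in A | X `&` Y != fset0]|.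

Let K := (1 + eps) / (1 - eps).
Hypotheses (eps0 : 0 <= eps) (eps1 : eps < 1)
  (degree : forall X, X \in U -> (meets X U <= d)%N)
  (small : forall X, X \in U -> w [fset X] * N (f X) * K ^+ d.-1 <= eps).

Let regroup (a b c x y : R) : a * (b * c * (x * y)) = b * x * (a * c * y).
Proof. by ring. Qed.

Let e1p : 0 < 1 - eps. Proof. by rewrite subr_gt0. Qed.

Let K1 : 1 <= K.
Proof.
by rewrite ler_pdivlMr// mul1r lerD2l (le_trans _ eps0)// oppr_le0.
Qed.

Let K0 : 0 <= K. Proof. exact: le_trans K1. Qed.

Let fset_ind (T : {fset {fset V}} -> Prop) : T fset0 ->
  (forall A X, A `<=` U -> X \in A -> T (A `\ X) -> T A) ->
  forall A, A `<=` U -> T A.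
Proof.
move=> T0 TS A; have [k] := ubnP #|` A|; elim: k A => // k IH A Ak AU.
have [->//|[X XA]] := fset_0Vmem A; apply: (TS _ X) => //.
apply: IH; last exact: fsubset_trans (fsubD1set _ _) AU.
by move: Ak; rewrite (cardfsD1 X) XA add1n ltnS.
Qed.

Let e_herm_Alg A : A `<=` U -> herm (e A) /\ Alg (e A).
Proof.
move: A; apply: fset_ind => [|A X AU XA [hA aA]].
  by rewrite e0; split=> //; exact: herm1.
have XU := fsubsetP AU _ XA.
have af : Alg (1 + f X) by apply: AlgD => //; exact: Alg_f.
rewrite (eD1 AU XA); split; last exact: AlgM.
apply: hermM => //; first exact: AlgC.
by apply: hermD; [exact: herm1|exact: herm_f].
Qed.

Let e_supp A Y : A `<=` U -> meets Y A = 0%N ->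
  exists2 W, Sup W (e A) & Y `&` W = fset0.
Proof.
move: A; apply: fset_ind => [_|A X AU XA IH].
  by exists fset0; rewrite ?fsetI0// e0.
move=> /eqP; rewrite cardfs_eq0 => /eqP m0.
have mX C : C \in A -> C `&` Y = fset0.
  move=> CA; apply/eqP/negPn/negP => CY.
  by have : C \in fset0 by rewrite -m0 !inE CA CY.
have [|W SW YW] := IH.
  apply/eqP; rewrite cardfs_eq0; apply/eqP/fsetP => C; rewrite !inE /=.
  by apply/negP => /andP[/andP[_ /mX ->]]; rewrite eqxx.
exists (W `|` X); last by rewrite fsetIUr YW fset0U fsetIC mX.
rewrite (eD1 AU XA); apply: SupM => //; apply: SupD => //.
exact: Sup_f (fsubsetP AU _ XA).
Qed.

Definition Zp B : M := E (e B).

Let wn := wnorm N U w.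

Let Zp_herm_Alg A : A `<=` U -> herm (Zp A) /\ Alg (Zp A).
Proof. by move=> /e_herm_Alg[hA aA]; split; [exact: E_herm|exact: AlgE]. Qed.

(** Stands for positive definiteness: it yields invertibility and, by uniqueness, the value of
    [mlog]. *)
Definition has_log Q := exists2 L, herm L & mexp L = Q.

Let has_log_unit Q : has_log Q -> Q \in unitmx.
Proof.
by case=> L hL <-; have [] := mulmx1_invmx (mexpN hL).
Qed.

(** [A] shrinks in the induction while [B] keeps ranging over the subfamilies of [U], so one and the
    same norm serves at every stage. *)
Let logs A := forall B, B `<=` U -> has_log (Zp (A `&` B)).
Let bounds A := forall Y Q, Alg Q -> Sup Y Q ->
  wn (fun B => E (Q * e (A `&` B)) * invmx (Zp (A `&` B))) <= N Q * K ^+ meets Y A.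

Let meetsD1 A X Y : X \in A ->
  meets Y A = ((X `&` Y != fset0) + meets Y (A `\ X))%N.
Proof.
move=> XA; rewrite /meets (cardfsD1 X) !inE XA /=; congr (_ + _)%N.
by congr #|` _|; apply/fsetP => C; rewrite !inE andbA.
Qed.

(** Since [U] omits the empty set, [X] meets itself and uses up one of the [d] places; hence the
    exponent [d.-1] in [small]. *)
Let meets_le_d A X : A `<=` U -> X \in A -> (meets X (A `\ X) <= d.-1)%N.
Proof.
move=> AU XA; have XU := fsubsetP AU _ XA.
have Xn : X `&` X != fset0 by rewrite fsetIid; apply: contra U0 => /eqP <-.
have := meetsD1 X XA; rewrite Xn add1n => mE.
have : (meets X A <= d)%N.
  apply: leq_trans (degree XU); apply: fsubset_leq_card; apply/fsubsetP => C.
  by rewrite !inE => /andP[/(fsubsetP AU) -> ->].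
by rewrite mE; case: d.
Qed.

Let meetsU A Y X : (meets (Y `|` X) A <= meets Y A + meets X A)%N.
Proof.
rewrite /meets -cardfsUI; apply: leq_trans (leq_addr _ _).
apply: fsubset_leq_card; apply/fsubsetP => C.
rewrite !inE => /andP[-> /=]; rewrite fsetIUr; apply: contraR.
by rewrite negb_or !negbK => /andP[/eqP -> /eqP ->]; rewrite fsetU0.
Qed.

Let AD1 A B X : X \in B -> (A `&` B) `\ X = (A `\ X) `&` B.
Proof. by move=> XB; apply/fsetP => C; rewrite !inE andbA. Qed.

Let AD1n A B X : X \notin B -> A `&` B = (A `\ X) `&` B.
Proof.
move=> XB; apply/fsetP => C; rewrite !inE.
by case: eqP => [->|]; rewrite ?(negbTE XB) ?andbF.
Qed.

Let sIU A B : A `<=` U -> A `&` B `<=` U.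
Proof. by move=> AU; apply: fsubset_trans (fsubsetIl _ _) AU. Qed.

(** * Removal of one set from the family *)

Section Ratio.
Variables (A : {fset {fset V}}) (X : {fset V}).
Hypotheses (AU : A `<=` U) (XA : X \in A).
Let A' := A `\ X.
Hypotheses (logA' : logs A') (bdA' : bounds A').

Let XU : X \in U. Proof. exact: (fsubsetP AU). Qed.
Let A'U : A' `<=` U. Proof. exact: fsubset_trans (fsubD1set _ _) AU. Qed.

(** The indicator makes the ratio vanish when [X] is absent from [B]: there removing [X] leaves [Zp]
    unchanged. *)
Definition rat B : M :=
  (if X \in B then 1 else 0) * (E (f X * e (A' `&` B)) * invmx (Zp (A' `&` B))).

Let uZ B : B `<=` U -> Zp (A' `&` B) \in unitmx.
Proof. by move=> BU; apply: has_log_unit; exact: logA'. Qed.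

(** The inductive bound applied to [f X], whose support meets at most [d.-1] of the remaining sets,
    leaves exactly the left side of [small]. *)
Lemma wn_rat : wn rat <= eps.
Proof.
apply: le_trans (wnormM N_ge0 N0 ND NM U w_ge1 wU _ _) _.
apply: le_trans (small XU); rewrite -mulrA; apply: ler_pM.
- exact: wnorm_ge0.
- exact: wnorm_ge0.
- exact: wnorm_in.
apply: le_trans (bdA' (Alg_f XU) (Sup_f XU)) _.
by rewrite ler_wpM2l// ler_weXn2l// meets_le_d.
Qed.

Let ef_Alg B : herm (E (f X * e (A' `&` B))) /\ Alg (E (f X * e (A' `&` B))).
Proof.
have [h a] := e_herm_Alg (sIU B A'U).
split; last by apply: AlgE; apply: AlgM => //; exact: Alg_f.
apply: E_herm; apply: hermM => //; last exact: herm_f.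
by apply: AlgC => //; exact: Alg_f.
Qed.

Lemma rat_comm B Q : B `<=` U -> Alg Q -> rat B * Q = Q * rat B.
Proof.
move=> BU aQ; rewrite /rat; case: ifP => _; last by rewrite !mul0r mulr0.
have [_ aZ] := Zp_herm_Alg (sIU B A'U); have [_ aE] := ef_Alg B.
have cZ := AlgC aZ aQ; have cE := AlgC aE aQ.
have ci := invmx_comm (uZ BU) cZ.
by rewrite !mul1r -mulrA ci mulrA cE mulrA.
Qed.

Lemma rat_herm B : B `<=` U -> herm (rat B).
Proof.
move=> BU; rewrite /rat; case: ifP => _; last by rewrite mul0r; exact: herm0.
have [hZ aZ] := Zp_herm_Alg (sIU B A'U); have [hE aE] := ef_Alg B.
rewrite mul1r; apply: hermM => //; last exact: herm_invmx (uZ BU) hZ.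
by apply/esym/(invmx_comm (uZ BU)); exact: AlgC.
Qed.

Lemma Zp_rat B : B `<=` U -> Zp (A `&` B) = (1 + rat B) * Zp (A' `&` B).
Proof.
move=> BU; rewrite /rat; case: ifPn => XB; last first.
  by rewrite mul0r addr0 mul1r (AD1n A XB).
have XAB : X \in A `&` B by rewrite !inE XA.
have [_ aA'] := e_herm_Alg (sIU B A'U).
rewrite mul1r {1}/Zp (eD1 (sIU B AU) XAB) (AD1 A XB) -/A'.
rewrite mulrDr mulr1 E_add (AlgC aA' (Alg_f XU)).
rewrite mulrDl mul1r -[X in _ = _ + X]mulrA.
have iZ : invmx (Zp (A' `&` B)) * Zp (A' `&` B) = 1 by exact: mulVmx (uZ BU).
by rewrite iZ mulr1.
Qed.

Lemma rat_log : exists lam : {fset {fset V}} -> M,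
  [/\ forall B, B `<=` U -> [/\ herm (lam B), mexp (lam B) = 1 + rat B &
                               1 + rat B \in unitmx] &
      wn lam <= eps / (1 - eps)].
Proof.
have H B : exists L, B `<=` U -> [/\ herm L, mexp L = 1 + rat B,
    forall t, 0 <= t <= 1 -> 1 + rC t *: rat B \in unitmx &
    forall k, (0 < k)%N -> opnorm (L - \sum_(j < k) rC k%:R^-1 *:
        (rat B * invmx (1 + rC (j%:R / k%:R) *: rat B))) <= k%:R^-1 * (1 - eps)^-1].
  have [BU|nBU] := boolP (B `<=` U); last by exists 0.
  have re : opnorm (rat B) <= eps.
    by rewrite -NE; apply: le_trans wn_rat; exact: le_wnorm.
  have [u [L [hL eL bL]]] := log1D (rat_herm BU) re eps1.
  by exists L.
have [lam Hlam] := choice H; exists lam; split.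
  move=> B BU; have [hL eL uL _] := Hlam B BU; split=> //.
  by have := uL 1; rewrite ler01 lexx rmorph1 scale1r; apply.
apply: (wnorm_log N_ge0 N0 NN ND NM N1 w_ge1 w0 wU wn_rat eps1) => k k0.
have kR : 0 < k%:R :> R by rewrite ltr0n.
exists (rC k%:R^-1 *: (1 : M)), (fun j : 'I_k => rC (j%:R / k%:R) *: (1 : M)),
  (fun (j : 'I_k) B => invmx (1 + rC (j%:R / k%:R) *: rat B)).
have Nsc x : N (rC x *: (1 : M)) <= `|x|.
  rewrite NE; apply: le_trans (opnormZ_le _ _) _; rewrite nc_rC.
  by rewrite ler_piMr// -NE.
have jk (j : 'I_k) : 0 <= (j%:R / k%:R : R) <= 1.
  by rewrite divr_ge0//= ler_pdivrMr// mul1r ler_nat ltnW.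
have scE (c : CC R) (a : M) : (c *: (1 : M)) * a = c *: a.
  by rewrite -[LHS]/((c *: 1%:M) *m a) -scalemxAl mul1mx.
split.
- by apply: le_trans (Nsc _) _; rewrite ger0_norm// invr_ge0 ltW.
- by move=> j; apply: le_trans (Nsc _) _; have /andP[j0 j1] := jk j; rewrite ger0_norm.
- move=> j B BU; have [_ _ uL _] := Hlam B BU.
  by rewrite scE; exact: mulmxV (uL _ (jk j)).
move=> B BU; have [_ _ _ bL] := Hlam B BU.
rewrite NE; apply: le_trans (bL k k0); rewrite le_eqVlt; apply/orP; left; apply/eqP.
by congr (opnorm (_ - _)); apply: eq_bigr => j _; rewrite scE.
Qed.

(** The logarithms of the two factors are not placed in [Alg]; they commute because their
    exponentials do, each being a polynomial in its exponential. *)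
Lemma logs_step : logs A.
Proof.
have [lam [Hlam _]] := rat_log.
move=> B BU; have [hl el _] := Hlam B BU; have [L hL eL] := logA' BU.
have [_ aZ] := Zp_herm_Alg (sIU B A'U).
have c1 : L * mexp (lam B) = mexp (lam B) * L.
  rewrite el; apply: (log_comm hL); rewrite eL mulrDr mulrDl mulr1 mul1r.
  by rewrite (rat_comm BU aZ).
have c2 : lam B * L = L * lam B by apply: (log_comm hl); rewrite c1.
exists (lam B + L); first exact: hermD.
by rewrite (mexpD hl hL c2) el eL Zp_rat.
Qed.

(** Numerator and denominator are both divided by the partition function without [X]. The numerator
    becomes [F0] plus a switched [F1], the latter for [Q * f X]: its support meets at most [d.-1]
    sets more than [Y], so [small] bounds it by eps times the bound on [F0]. The denominator becomes
    1 + [rat]. *)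
Lemma bounds_step Y Q : X `&` Y != fset0 -> Alg Q -> Sup Y Q ->
  wn (fun B => E (Q * e (A `&` B)) * invmx (Zp (A `&` B))) <= N Q * K ^+ meets Y A.
Proof.
move=> XY aQ sQ; have [lam [Hlam _]] := rat_log.
pose F0 B := E (Q * e (A' `&` B)) * invmx (Zp (A' `&` B)).
pose F1 B := E (Q * f X * e (A' `&` B)) * invmx (Zp (A' `&` B)).
pose G B := invmx (1 + rat B).
pose ind B : M := if X \in B then 1 else 0.
rewrite /wn (@wnorm_ext _ _ _ _ _ _ _ (fun B => (F0 B + ind B * F1 B) * G B)); last first.
  move=> B BU; have [_ _ uR] := Hlam B BU.
  have -> : invmx (Zp (A `&` B)) = invmx (Zp (A' `&` B)) * G B.
    have /mulmx1_invmx[_ ->//] :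
        Zp (A `&` B) * (invmx (Zp (A' `&` B)) * G B) = 1.
    rewrite (Zp_rat BU) -mulrA [Zp _ * _]mulrA.
    have iZ : Zp (A' `&` B) * invmx (Zp (A' `&` B)) = 1 by exact: mulmxV (uZ BU).
    by rewrite iZ mul1r; exact: mulmxV.
  rewrite mulrA; congr (_ * _); rewrite /F0 /F1 /ind; case: ifPn => XB; last first.
    by rewrite mul0r addr0 (AD1n A XB).
  have XAB : X \in A `&` B by rewrite !inE XA.
  have [_ aA'] := e_herm_Alg (sIU B A'U).
  rewrite (eD1 (sIU B AU) XAB) (AD1 A XB) -/A'.
  rewrite mulrDr mulr1 mulrDr E_add mulrDl mul1r.
  by rewrite (AlgC aA' (Alg_f XU)) mulrA.
apply: le_trans (wnormM N_ge0 N0 ND NM U w_ge1 wU _ _) _.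
have wG : wn G <= (1 - eps)^-1.
  apply: (wnorm_inv N_ge0 N0 NN ND NM N1 w_ge1 w0 wU wn_rat eps1) => B BU.
  by have [_ _ uR] := Hlam B BU; exact: mulmxV.
have wF0 : wn F0 <= N Q * K ^+ meets Y A' by exact: bdA'.
have wF1 : wn (fun B => ind B * F1 B) <= N Q * K ^+ meets Y A' * eps.
  apply: le_trans (wnormM N_ge0 N0 ND NM U w_ge1 wU _ _) _.
  apply: (@le_trans _ _ (w [fset X] * (N (Q * f X) * K ^+ meets (Y `|` X) A'))).
    apply: ler_pM; [exact: wnorm_ge0|exact: wnorm_ge0|exact: wnorm_in|].
    by apply: bdA'; [apply: AlgM => //; exact: Alg_f|apply: SupM => //; exact: Sup_f].
  apply: (@le_trans _ _ (w [fset X] * (N Q * N (f X) * (K ^+ meets Y A' * K ^+ d.-1)))).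
    have w0' : 0 <= w [fset X] by exact: le_trans (w_ge1 _).
    apply: ler_wpM2l => //; apply: ler_pM => //; first exact: exprn_ge0.
    rewrite -exprD; apply: ler_weXn2l => //.
    by apply: leq_trans (meetsU _ _ _) _; rewrite leq_add2l meets_le_d.
  rewrite regroup.
  by apply: ler_wpM2l; [rewrite mulr_ge0// exprn_ge0|exact: small].
apply: (@le_trans _ _ ((N Q * K ^+ meets Y A' * (1 + eps)) * (1 - eps)^-1)).
  apply: ler_pM => //; try exact: wnorm_ge0.
  apply: le_trans (wnormD ND U w_ge1 _ _) _.
  by rewrite mulrDr mulr1 lerD.
by rewrite (meetsD1 Y XA) XY add1n exprS -[leLHS]mulrA -/K -[leLHS]mulrA [_ * K]mulrC.
Qed.

End Ratio.

(** [logs A] may remove any set and comes before [bounds A], which needs [Zp] invertible even when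
    nothing is removed. For [bounds A] the removed set must meet [Y], so that the exponent drops; if
    none does, the ratio is the constant [E Q]. *)
Lemma cluster A : A `<=` U -> logs A /\ bounds A.
Proof.
have mem_bounds A' Y Q : A' `<=` U -> logs A' -> Alg Q -> Sup Y Q -> meets Y A' = 0%N ->
  wn (fun B => E (Q * e (A' `&` B)) * invmx (Zp (A' `&` B))) <= N Q * K ^+ meets Y A'.
  move=> A'U lA' aQ sQ m0; rewrite m0 expr0 mulr1.
  rewrite /wn (@wnorm_ext _ _ _ _ _ _ _ (fun=> E Q)) => [|B BU].
    by rewrite (wnorm_cst N0 U w0).
  have m0B : meets Y (A' `&` B) = 0%N.
    apply/eqP; rewrite -leqn0 -m0; apply: fsubset_leq_card; apply/fsubsetP => C.
    by rewrite !inE => /andP[/andP[-> _] ->].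
  have [W sW YW] := e_supp (sIU B A'U) m0B.
  have iZ : Zp (A' `&` B) * invmx (Zp (A' `&` B)) = 1.
    exact: mulmxV (has_log_unit (lA' B BU)).
  by rewrite (E_fact sQ sW YW) -mulrA iZ mulr1.
have [k] := ubnP #|` A|; elim: k A => // k IH A Ak AU.
have IHX X : X \in A -> logs (A `\ X) /\ bounds (A `\ X).
  move=> XA; apply: IH; last exact: fsubset_trans (fsubD1set _ _) AU.
  by move: Ak; rewrite (cardfsD1 X) XA add1n ltnS.
have lA : logs A.
  have [A0|[X XA]] := fset_0Vmem A.
    move=> B BU; rewrite A0 fset0I /Zp e0 E1; exists 0; first exact: herm0.
    exact: mexp0.
  by have [l1 b1] := IHX X XA; exact: (logs_step AU XA l1 b1).
split=> // Y Q aQ sQ.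
have [m0|m0] := eqVneq (meets Y A) 0%N; first exact: mem_bounds.
have [F0|[X]] := fset_0Vmem [fset X in A | X `&` Y != fset0].
  by rewrite /meets F0 cardfs0 in m0.
rewrite !inE => /andP[XA XY]; have [l1 b1] := IHX X XA.
exact: (bounds_step AU XA l1 b1).
Qed.

Lemma cluster_has_log B : B `<=` U -> has_log (Zp B).
Proof.
move=> BU; have [lU _] := cluster (fsubset_refl U).
by have := lU B BU; have /fsetIidPr -> := BU.
Qed.

(** With all of [U] present, [mlog (Zp C)] is [lam C] plus a function of [C] without [X], and
    [mob_pinned] discards the latter. *)
Lemma cluster_bound X : X \in U ->
  \sum_(B <- fpowerset U | X \in B) w B * N (mob (fun B => mlog (Zp B)) B)
    <= eps / (1 - eps).
Proof.
move=> XU; have [l1 b1] := cluster (fsubset_trans (fsubD1set U X) (fsubset_refl U)).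
have [lam [Hlam wlam]] := rat_log (fsubset_refl U) XU l1 b1.
apply: le_trans wlam; rewrite /wn /wnorm [leRHS](bigID (fun B => X \in B)) /=.
rewrite -[leLHS]addr0; apply: lerD; last first.
  by apply: sumr_ge0 => B _; rewrite mulr_ge0// (le_trans _ (w_ge1 _)).
rewrite le_eqVlt; apply/orP; left; apply/eqP.
rewrite big_seq_cond [RHS]big_seq_cond; apply: eq_bigr => B /andP[].
rewrite fpowersetE => BU XB; congr (_ * N _).
rewrite (@mob_ext _ _ U _ (fun C => lam C + mlog (Zp (C `\ X)))) // => [|C CU].
  by rewrite mobD (mob_pinned (fun C => mlog (Zp C)) XB) addr0.
have [hl el _] := Hlam C CU.
have CE : C `\ X = (U `\ X) `&` C.
  apply/fsetP => D; rewrite !inE; case: (boolP (D \in C)) => DC; rewrite ?andbF//.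
  by rewrite (fsubsetP CU _ DC) !andbT.
have [L hL eL] := cluster_has_log (fsubset_trans (fsubD1set C X) CU).
rewrite (mlogE hL eL).
have [_ aZ] := Zp_herm_Alg (fsubset_trans (fsubD1set C X) CU).
have c1 : L * mexp (lam C) = mexp (lam C) * L.
  rewrite el; apply: (log_comm hL); rewrite eL mulrDr mulrDl mulr1 mul1r.
  by rewrite (rat_comm (fsubset_refl U) XU l1 CU aZ).
have c2 : lam C * L = L * lam C by apply: (log_comm hl); rewrite c1.
apply: mlogE; first exact: hermD.
rewrite (mexpD hl hL c2) el eL CE -(Zp_rat (fsubset_refl U) XU l1 CU).
by have /fsetIidPr -> := CU.
Qed.

End Cluster.

(** * Effective interactions *)

Section Numerics.
Variable R : realType.

(** Here q is |beta| |Phi_X| and B is e^(b X). The hypothesis gives q <= 2/d, and e^q - 1 <= q e^q.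
    As (1 + eps) / (1 - eps) = 1 + 2/d <= e^(2/d), the d exponentials combine to e^2, leaving q B
    e^2 <= eps. *)
Lemma cluster_small (d : nat) (q B eps : R) : (0 < d)%N -> 0 <= q -> 1 <= B ->
  eps = (d.+1%:R)^-1 -> q * B * ((d * (1 + d))%:R * expR 2) <= 1 ->
  B * (expR q - 1) * ((1 + eps) / (1 - eps)) ^+ d.-1 <= eps.
Proof.
move=> d0 q0 B1 -> qB.
have dR : 0 < d%:R :> R by rewrite ltr0n.
have d1 : 1 <= d%:R :> R by rewrite ler1n.
have SR : d.+1%:R = d%:R + 1 :> R by rewrite natr1.
have KE : (1 + d.+1%:R^-1) / (1 - d.+1%:R^-1) = 1 + 2 / d%:R :> R.
  rewrite SR; have D1 : d%:R + 1 != 0 :> R by rewrite gt_eqF// addr_gt0.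
  have dn : d%:R != 0 :> R by rewrite gt_eqF.
  have -> : 1 - (d%:R + 1)^-1 = d%:R / (d%:R + 1) :> R by field.
  by field; rewrite dn D1.
have B0 : 0 < B by apply: lt_le_trans B1.
have e2 : 1 <= expR 2 :> R by apply: le_trans (expR_ge1Dx _); lra.
have qBd : q * B * expR 2 * d%:R <= (d%:R + 1)^-1.
  rewrite -[leRHS]mul1r ler_pdivlMr ?addr_gt0//; apply: le_trans qB.
  by rewrite natrM natrD le_eqVlt; apply/orP; left; apply/eqP; ring.
have qd : q <= 2 / d%:R.
  rewrite ler_pdivlMr//.
  have h1 : q * d%:R <= q * B * expR 2 * d%:R.
    rewrite ler_wpM2r ?(ltW dR)// -mulrA ler_peMr//.
    by rewrite -[leLHS]mul1r ler_pM.
  have h2 : (d%:R + 1)^-1 <= 1 :> R by rewrite invf_le1 ?addr_gt0// lerDr ltW.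
  by apply: le_trans h1 _; apply: le_trans qBd _; apply: le_trans h2 _; rewrite ler1n.
have eq1 : expR q - 1 <= q * expR q.
  have := expR_ge1Dx (- q); rewrite expRN => h.
  have p := expR_gt0 q.
  have : (1 - q) * expR q <= 1 by rewrite -ler_pdivlMr// mul1r.
  by rewrite mulrBl mul1r => h'; rewrite lerBlDr -lerBlDl.
have K1 : 0 <= 1 + 2 / d%:R :> R by rewrite addr_ge0// divr_ge0// ltW.
have K0 : 0 <= (1 + 2 / d%:R) ^+ d.-1 :> R by exact: exprn_ge0.
have KX : expR q * (1 + 2 / d%:R) ^+ d.-1 <= expR 2.
  apply: (@le_trans _ _ (expR (2 / d%:R) * expR (2 / d%:R) ^+ d.-1)).
    apply: ler_pM; [exact: expR_ge0|exact: K0|by rewrite ler_expR|].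
    by apply: lerXn2r; rewrite ?nnegrE ?expR_ge0 ?expR_ge1Dx ?K1.
  by rewrite -exprS prednK// -expRM_natl mulrC divfK// gt_eqF.
rewrite KE; apply: (@le_trans _ _ (B * (q * expR q) * (1 + 2 / d%:R) ^+ d.-1)).
  by rewrite ler_wpM2r// ler_wpM2l// ltW.
apply: (@le_trans _ _ (q * B * expR 2)).
  rewrite [B * _]mulrA [B * q]mulrC -[leLHS]mulrA ler_wpM2l//.
  by rewrite mulr_ge0// ltW.
rewrite SR; apply: le_trans qBd.
rewrite ler_peMr// !mulr_ge0 ?expR_ge0// ltW//.
Qed.

End Numerics.

(** * Supports and factorization *)

Section Interaction.
Variables (R : realType) (V : choiceType) (D : nat).
Hypothesis D0 : (0 < D)%N.
Local Notation Op := (Op R D).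
Implicit Types (X Y W Lam : {fset V}) (L : set V) (A B C : {fset {fset V}}).

Let fs X : set V := [set x | x \in X].

Section Support.
Variable Lam : {fset V}.
Implicit Types Q P : Op Lam.

(** Support as a fixed-point condition inside one volume, which the composition and module rules of
    [econd] handle directly. *)
Definition suppd X Q : Prop := econd (fs X) Q = Q.

Lemma suppd_sub L X Q : suppd X Q -> (fs X `<=` L)%classic -> econd L Q = Q.
Proof.
by move=> sQ XL; rewrite -{1}sQ (econd_comp D0) setIC setIidl.
Qed.

Lemma suppdM X Y Q P : suppd X Q -> suppd Y P -> suppd (X `|` Y) (Q * P).
Proof.
move=> sQ sP.
have eQ : econd (fs (X `|` Y)) Q = Q.
  by apply: (suppd_sub sQ) => x; rewrite /fs /= inE => ->.
have eP : econd (fs (X `|` Y)) P = P.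
  by apply: (suppd_sub sP) => x; rewrite /fs /= inE => ->; rewrite orbT.
by rewrite /suppd -[in LHS]eQ (econdMl D0) eQ eP.
Qed.

(** Insert the expectation onto the union of [L] and [Y]: it fixes [P] and acts on [Q] as [econd L],
    since [X] and [Y] are disjoint. The two module properties then split the product. *)
Lemma econd_fact L X Y Q P : suppd X Q -> suppd Y P -> X `&` Y = fset0 ->
  econd L (Q * P) = econd L Q * econd L P.
Proof.
move=> sQ sP XY; pose L' := (L `|` fs Y)%classic.
have eP : econd L' P = P by apply: (suppd_sub sP); exact: subsetUr.
have LX : (L' `&` fs X = L `&` fs X)%classic.
  apply/seteqP; split=> x [Lx Xx]; split=> //; last by left.
  case: Lx => // Yx; have : x \in X `&` Y by rewrite inE Xx.
  by rewrite XY inE.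
have eQ : econd L' Q = econd L Q by rewrite -sQ !(econd_comp D0) LX.
have -> : econd L (Q * P) = econd L (econd L' (Q * P)).
  by rewrite (econd_comp D0) setIidl//; exact: subsetUl.
by rewrite -{1}eP (econdMr D0) eP eQ (econdMl D0).
Qed.

Lemma econd0 L : econd L (0 : Op Lam) = 0.
Proof. by rewrite -(scale0r (0 : Op Lam)) (econdZ D0) !scale0r. Qed.

Lemma econd_sum L I (r : seq I) (p : pred I) (F : I -> Op Lam) :
  econd L (\sum_(i <- r | p i) F i) = \sum_(i <- r | p i) econd L (F i).
Proof. exact: (big_morph _ (@econdD R V D D0 L Lam) (econd0 L)). Qed.

Lemma pev_fixed L Q p : econd L Q = Q -> econd L (pev p Q) = pev p Q.
Proof.
move=> eQ; rewrite /pev econd_sum; apply: eq_bigr => k _.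
rewrite (econdZ D0); congr (_ *: _).
elim: (k : nat) => [|m IH]; first by rewrite !expr0 (econd1 _ D0).
by rewrite exprS -{1}eQ (econdMl D0) eQ IH.
Qed.

End Support.

End Interaction.

(** * Construction of the effective interaction *)

Section Main.
Variables (R : realType) (V : choiceType) (D : nat) (Phi : interaction R V D).
Variables (b : {fset V} -> R) (d : nat) (beta : R).
Variable Alg0 : forall X : {fset V}, set (Op R D X).
Hypotheses (D0 : (0 < D)%N) (Phi_herm : local_interaction Phi).
Hypothesis Alg0_emb : forall (X Y : {fset V}) (Q : Op R D X),
  X `<=` Y -> (Alg0 Q <-> Alg0 (emb Y Q)).
Hypothesis Alg0_ring : forall X (Q P : Op R D X), Alg0 Q -> Alg0 P ->
  [/\ Alg0 (Q + P), Alg0 (Q * P) & Q * P = P * Q].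
Hypothesis Alg0_scale : forall X (c : CC R) (Q : Op R D X), Alg0 Q -> Alg0 (c *: Q).
Hypothesis Alg0_Phi : forall X, Alg0 (Phi X).
Hypothesis Alg0_econd : forall (L : set V) (Lam : {fset V}) (Q : Op R D Lam),
  Alg0 Q -> Alg0 (econd L Q).
Hypotheses (b_ge0 : forall X, 0 <= b X) (b_sub : b_subadditive b).
Hypotheses (bnorm_fin : (bnorm b Phi < +oo)%E) (Phi_deg : finite_degree Phi d).
Hypothesis beta_small :
  `|beta| * ((d * (1 + d))%:R * expR 2 * fine (bnorm b Phi)) < 1.

Local Notation Op := (Op R D).
Implicit Types (X Y W Lam : {fset V}) (L : set V) (A B C : {fset {fset V}}).

Definition gint Lam X : Op Lam := rC (- beta) *: emb Lam (Phi X).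
Definition gham Lam B : Op Lam := \sum_(X <- B) gint Lam X.
(** The empty set is left out: it meets nothing, and no site sum in [bnorm] controls its term.
    Vanishing terms are left out because the degree counts only nonzero ones. *)
Definition active Lam : {fset {fset V}} :=
  [fset X in fpowerset Lam | (X != fset0) && (Phi X != 0)].
Definition logZ L Lam B : Op Lam := mlog (econd L (mexp (gham Lam B))).
Definition cover B : {fset V} := \big[fsetU/fset0]_(X <- B) X.
(** The coefficients are computed in the volume [X] itself, so no ambient volume enters. The first
    summand restores the scalar [Phi fset0]. *)
Definition eff L X : Op X :=
  (if X == fset0 then rC (- beta) *: Phi X else 0) +
  \sum_(B <- fpowerset (active X) | cover B == X) mob (logZ L X) B.

Lemma in_active Lam X :
  (X \in active Lam) = [&& X `<=` Lam, X != fset0 & Phi X != 0].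
Proof. by rewrite !inE fpowersetE. Qed.

Lemma activeP Lam X : X \in active Lam -> [/\ X `<=` Lam, X != fset0 & Phi X != 0].
Proof. by rewrite in_active => /and3P. Qed.

Lemma gint_herm Lam X : X `<=` Lam -> herm (gint Lam X).
Proof. by move=> XL; apply/hermZ/(emb_herm XL)/Phi_herm. Qed.

Lemma active_sub Lam B X : B `<=` active Lam -> X \in B -> X `<=` Lam.
Proof. by move=> BL XB; have /activeP[] := fsubsetP BL _ XB. Qed.

Lemma gham_herm Lam B : B `<=` active Lam -> herm (gham Lam B).
Proof.
move=> BL; rewrite /herm /gham adj_sum; apply: eq_big_seq => X XB.
exact: gint_herm (active_sub BL XB).
Qed.

Lemma gint_Alg Lam X : X `<=` Lam -> Alg0 (gint Lam X).
Proof. by move=> XL; apply/Alg0_scale/(Alg0_emb _ XL). Qed.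

Lemma gint_comm Lam X Y : X `<=` Lam -> Y `<=` Lam ->
  gint Lam X * gint Lam Y = gint Lam Y * gint Lam X.
Proof.
by move=> XL YL; have [] := Alg0_ring (gint_Alg XL) (gint_Alg YL).
Qed.

Lemma gham_comm Lam B X : B `<=` active Lam -> X `<=` Lam ->
  gham Lam B * gint Lam X = gint Lam X * gham Lam B.
Proof.
move=> BL XL; rewrite /gham mulr_suml mulr_sumr; apply: eq_big_seq => Y YB.
exact: gint_comm (active_sub BL YB) XL.
Qed.

Lemma ghamD1 Lam B X : X \in B -> gham Lam B = gham Lam (B `\ X) + gint Lam X.
Proof. by move=> XB; rewrite /gham (big_fsetD1 X)//= addrC. Qed.

(** [Alg0] need not contain the unit, which exponentials involve; adjoining scalars keeps
    commutativity and stability under [econd]. *)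
Definition AlgU Lam : set (Op Lam) :=
  [set Q : Op Lam | exists (c : CC R) (a : Op Lam), Alg0 a /\ Q = c *: (1 : Op Lam) + a].

Section AlgebraWithUnit.
Variable Lam : {fset V}.
Implicit Types Q P : Op Lam.

Let zA : Alg0 (0 : Op Lam).
Proof. by rewrite -(scale0r (Phi Lam)); exact: Alg0_scale. Qed.

Lemma AlgU0 Q : Alg0 Q -> AlgU Q.
Proof. by move=> aQ; exists 0, Q; rewrite scale0r add0r. Qed.

Lemma AlgU1 : AlgU (1 : Op Lam).
Proof. by exists 1, 0; rewrite scale1r addr0. Qed.

Lemma AlgUZ c Q : AlgU Q -> AlgU (c *: Q).
Proof.
move=> [c' [a [aA ->]]]; exists (c * c'), (c *: a); split; first exact: Alg0_scale.
by rewrite scalerDr scalerA.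
Qed.

Lemma AlgUD Q P : AlgU Q -> AlgU P -> AlgU (Q + P).
Proof.
move=> [c [a [aA ->]]] [c' [a' [aA' ->]]]; exists (c + c'), (a + a').
by have [] := Alg0_ring aA aA'; rewrite scalerDl addrACA.
Qed.

Let scE c Q : (c *: (1 : Op Lam)) * Q = c *: Q.
Proof. by rewrite -[LHS]/((c *: 1%:M) *m Q) -scalemxAl mul1mx. Qed.

Let scEr c Q : Q * (c *: (1 : Op Lam)) = c *: Q.
Proof. by rewrite -[LHS]/(Q *m (c *: 1%:M)) -scalemxAr mulmx1. Qed.

Lemma AlgUM Q P : AlgU Q -> AlgU P -> AlgU (Q * P).
Proof.
move=> [c [a [aA ->]]] [c' [a' [aA' ->]]].
exists (c * c'), (c *: a' + (c' *: a + a * a')); split.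
  have [_ aa _] := Alg0_ring aA aA'.
  have [h _ _] := Alg0_ring (Alg0_scale c' aA) aa.
  by have [] := Alg0_ring (Alg0_scale c aA') h.
by rewrite mulrDl !mulrDr !scE scEr scalerA -addrA.
Qed.

Lemma AlgUC Q P : AlgU Q -> AlgU P -> Q * P = P * Q.
Proof.
move=> [c [a [aA ->]]] [c' [a' [aA' ->]]].
have [_ _ aa] := Alg0_ring aA aA'.
rewrite !mulrDl !mulrDr !scE !scEr !scalerA aa [c' * c]mulrC.
by rewrite -!addrA; congr (_ + _); rewrite addrCA.
Qed.

Lemma AlgUE L Q : AlgU Q -> AlgU (econd L Q).
Proof.
move=> [c [a [aA ->]]]; exists c, (econd L a); split; first exact: Alg0_econd.
by rewrite (econdD D0) (econdZ D0) (econd1 _ D0).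
Qed.

Lemma AlgU_mexp Q : herm Q -> AlgU Q -> AlgU (mexp Q).
Proof.
move=> hQ aQ; have [p [-> _]] := mexp_pev hQ hQ; rewrite /pev.
elim/big_ind: _; [exact: AlgU0|exact: AlgUD|move=> k _].
apply: AlgUZ; elim: (k : nat) => [|m IH]; first by rewrite expr0; exact: AlgU1.
by rewrite exprS; exact: AlgUM.
Qed.

End AlgebraWithUnit.

(** The weight of the empty family is set to 1, as [b fset0] may be positive while constants must
    keep their plain norm. *)
Definition wcover B : R := if B == fset0 then 1 else expR (b (cover B)).

Lemma coverP B x : reflect (exists2 X, X \in B & x \in X) (x \in cover B).
Proof.
by apply: (iffP (bigfcupP _ _ _ _)) => -[X]; rewrite ?andbT => XB xX; exists X;
  rewrite ?andbT.
Qed.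

Lemma coverU B C : cover (B `|` C) = cover B `|` cover C.
Proof.
apply/fsetP => x; rewrite inE; apply/coverP/orP => [[X]|].
  by rewrite inE => /orP[XB|XC] xX; [left|right]; apply/coverP; exists X.
by case=> /coverP[X XB xX]; exists X; rewrite // inE XB ?orbT.
Qed.

Lemma cover1 X : cover [fset X] = X.
Proof. by rewrite /cover big_seq_fset1. Qed.

Lemma wcover_ge1 B : 1 <= wcover B.
Proof.
rewrite /wcover; case: ifP => // _; apply: le_trans (expR_ge1Dx _).
by rewrite lerDl.
Qed.

Lemma wcoverU B C : wcover (B `|` C) <= wcover B * wcover C.
Proof.
have [->|B0] := eqVneq B fset0; first by rewrite fset0U /wcover eqxx mul1r.
have [->|C0] := eqVneq C fset0; first by rewrite fsetU0 /wcover eqxx mulr1.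
rewrite /wcover (negbTE B0) (negbTE C0) fsetU_eq0 (negbTE B0) /=.
by rewrite -expRD ler_expR coverU; exact: b_sub.
Qed.

Lemma opnorm_Phi_le X : X != fset0 -> opnorm (Phi X) * expR (b X) <= fine (bnorm b Phi).
Proof.
case/fset0Pn => x xX.
have term_ge0 Y : (0 <= (opnorm (Phi Y) * expR (b Y))%:E)%E.
  by rewrite lee_fin mulr_ge0 ?opnorm_ge0 ?expR_ge0.
have h : ((opnorm (Phi X) * expR (b X))%:E <= bnorm b Phi)%E.
  apply: (@le_trans _ _ (\esum_(Y in [set Y : {fset V} | x \in Y])
      (opnorm (Phi Y) * expR (b Y))%:E)%E).
    apply: esum_ge; exists [set X]; last by rewrite fsbig_set1.
    by split; [exact: finite_set1|move=> Y /= ->].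
  by apply: ereal_sup_ubound; exists x.
rewrite -lee_fin fineK// ge0_fin_numE//.
exact: le_trans h.
Qed.

Lemma active_d_gt0 Lam X : X \in active Lam -> (0 < d)%N.
Proof.
move=> /activeP[_ X0 PX]; have := Phi_deg PX (Ys := [fset X]).
rewrite cardfs1; apply => Y; rewrite inE => /eqP ->; split=> //.
by rewrite fsetIid.
Qed.

Lemma active_deg Lam X : X \in active Lam -> (meets X (active Lam) <= d)%N.
Proof.
move=> /activeP[_ _ PX]; apply: (Phi_deg PX) => Y; rewrite !inE /= => /andP[+ YX].
by move=> /andP[_ /andP[_ PY]].
Qed.

Lemma mexp_ghamD1 Lam A X : A `<=` active Lam -> X \in A ->
  mexp (gham Lam A) = mexp (gham Lam (A `\ X)) * (1 + (mexp (gint Lam X) - 1)).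
Proof.
move=> AL XA; have A'L := fsubset_trans (fsubD1set A X) AL.
have XL := active_sub AL XA.
rewrite [in LHS](ghamD1 _ XA) [in RHS]addrC subrK.
exact: mexpD (gham_herm A'L) (gint_herm XL) (gham_comm A'L XL).
Qed.

Lemma active_small Lam X eps : X \in active Lam -> eps = (d.+1%:R)^-1 ->
  wcover [fset X] * opnorm (mexp (gint Lam X) - 1) *
    ((1 + eps) / (1 - eps)) ^+ d.-1 <= eps.
Proof.
move=> XL epsE; have d0 := active_d_gt0 XL; have /activeP[XLam X0 PX] := XL.
pose q := `|beta| * opnorm (Phi X).
have q0 : 0 <= q by rewrite mulr_ge0 ?opnorm_ge0.
have wX : wcover [fset X] = expR (b X).
  by rewrite /wcover cover1; case: eqP => // /fsetP /(_ X); rewrite !inE eqxx.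
have w1 := wcover_ge1 [fset X]; rewrite wX in w1 *.
have eps_ge0 : 0 <= (1 + eps) / (1 - eps).
  rewrite epsE; apply: divr_ge0; first by rewrite addr_ge0 ?invr_ge0.
  by rewrite subr_ge0 invf_le1 ?ltr0n// ler1n.
have gq : opnorm (gint Lam X) <= q.
  apply: le_trans (opnormZ_le _ _) _; rewrite nc_rC normrN ler_wpM2l//.
  exact: opnorm_emb_le.
apply: le_trans (cluster_small d0 q0 w1 epsE _).
  rewrite ler_wpM2r ?exprn_ge0// ler_wpM2l ?expR_ge0//.
  apply: le_trans (opnorm_mexpB1 (gint_herm XLam)) _.
  by rewrite lerD2r ler_expR.
apply: le_trans (ltW beta_small).
have -> : q * expR (b X) * ((d * (1 + d))%:R * expR 2) =
    `|beta| * ((d * (1 + d))%:R * expR 2 * (opnorm (Phi X) * expR (b X))).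
  have gen (u x1 x2 x3 x4 : R) : u * x1 * x2 * (x4 * x3) = u * (x4 * x3 * (x1 * x2)).
    by ring.
  exact: gen.
by rewrite ler_wpM2l// ler_wpM2l ?opnorm_Phi_le.
Qed.

Lemma cluster_active L Lam :
  (forall B, B `<=` active Lam -> has_log (econd L (mexp (gham Lam B)))) /\
  (forall X, X \in active Lam ->
    \sum_(B <- fpowerset (active Lam) | X \in B)
      wcover B * opnorm (mob (logZ L Lam) B) <= d%:R^-1).
Proof.
(* Without active sets [d] may be 0, and then eps would equal 1; this case is trivial. *)
have [A0|[X0 X0A]] := fset_0Vmem (active Lam).
  rewrite A0; split=> [B|X]; last by rewrite inE.
  rewrite fsubset0 => /eqP ->; exists 0; first exact: herm0.
  by rewrite mexp0 /gham big_seq_fset0 mexp0 (econd1 _ D0).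
have d0 := active_d_gt0 X0A.
pose eps : R := (d.+1%:R)^-1.
have eps0 : 0 <= eps by rewrite invr_ge0.
have eps1 : eps < 1 by rewrite invf_lt1 ?ltr0n// ltr1n ltnS.
have epsE : eps / (1 - eps) = d%:R^-1.
  have dn : d%:R != 0 :> R by rewrite pnatr_eq0 -lt0n.
  have Dn : d%:R + 1 != 0 :> R by rewrite natr1 pnatr_eq0.
  rewrite /eps -natr1; have -> : 1 - (d%:R + 1)^-1 = d%:R / (d%:R + 1) :> R by field.
  by field; rewrite dn Dn.
pose e B := mexp (gham Lam B); pose f X := mexp (gint Lam X) - 1.
have Sup_f X : X \in active Lam -> suppd X (f X).
  move=> /activeP[XL _ _]; have [p [pE _]] := mexp_pev (gint_herm XL) (gint_herm XL).
  have m1 : econd [set x | x \in X] (1 : Op Lam) = 1 by exact: econd1.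
  have mN : econd [set x | x \in X] (- 1 : Op Lam) = - 1.
    by rewrite -scaleN1r (econdZ D0) m1.
  rewrite /suppd /f (econdD D0) mN; congr (_ - _); rewrite [mexp _]pE.
  apply: (pev_fixed D0); rewrite /gint (econdZ D0); congr (_ *: _).
  exact: econd_supp.
have Alg_f X : X \in active Lam -> AlgU (f X).
  move=> /activeP[XL _ _]; apply: AlgUD.
    by apply: AlgU_mexp; [exact: gint_herm|apply: AlgU0; exact: gint_Alg].
  by rewrite -scaleN1r; apply: AlgUZ; exact: AlgU1.
have herm_f X : X \in active Lam -> herm (f X).
  move=> /activeP[XL _ _]; apply: hermD; first exact: mexp_herm (gint_herm XL).
  by apply: hermN; exact: herm1.
have e0 : e fset0 = 1 by rewrite /e /gham big_seq_fset0 mexp0.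
have U0 : fset0 \notin active Lam by rewrite in_active eqxx andbF.
have w0 : wcover fset0 = 1 by rewrite /wcover eqxx.
have small X : X \in active Lam ->
    wcover [fset X] * opnorm (f X) * ((1 + eps) / (1 - eps)) ^+ d.-1 <= eps.
  by move=> XL; exact: active_small.
have Eherm Q : herm Q -> herm (econd L (Q : Op Lam)).
  by move=> hQ; rewrite /herm -(econd_adj D0) hQ.
have Sup1 Y : suppd Y (1 : Op Lam) by exact: econd1.
have SupD Y (Q P : Op Lam) : suppd Y Q -> suppd Y P -> suppd Y (Q + P).
  by move=> sQ sP; rewrite /suppd (econdD D0) sQ sP.
split=> [B BL|X XL].
  exact: (cluster_has_log (E := @econd R V D L Lam) (e := e) erefl wcover_ge1 w0 wcoverU (@econdD R V D D0 L Lam)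
    (econd1 R D0 L Lam) (@opnorm_econd R V D D0 L Lam) Eherm (@econd_fact R V D D0 Lam L)
    Sup1 SupD (@suppdM R V D D0 Lam) Sup_f (@AlgU1 Lam) (@AlgUD Lam) (@AlgUM Lam)
    (@AlgUC Lam) (@AlgUE Lam L) Alg_f herm_f e0 (@mexp_ghamD1 Lam) U0 eps0 eps1
    (@active_deg Lam) small BL).
rewrite -epsE.
exact: (cluster_bound (E := @econd R V D L Lam) (e := e) erefl wcover_ge1 w0 wcoverU (@econdD R V D D0 L Lam)
    (econd1 R D0 L Lam) (@opnorm_econd R V D D0 L Lam) Eherm (@econd_fact R V D D0 Lam L)
    Sup1 SupD (@suppdM R V D D0 Lam) Sup_f (@AlgU1 Lam) (@AlgUD Lam) (@AlgUM Lam)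
    (@AlgUC Lam) (@AlgUE Lam L) Alg_f herm_f e0 (@mexp_ghamD1 Lam) U0 eps0 eps1
    (@active_deg Lam) small XL).
Qed.

(** [logZ] is a polynomial in a partial trace, which [econd L] fixes by idempotence, and the fixed
    points of [econd L] are closed under products. *)
Lemma logZ_props L Lam B : B `<=` active Lam ->
  [/\ herm (logZ L Lam B), econd L (logZ L Lam B) = logZ L Lam B &
      mexp (logZ L Lam B) = econd L (mexp (gham Lam B))].
Proof.
move=> BL; have [/(_ B BL)[A hA eA] _] := cluster_active L Lam.
have lE : logZ L Lam B = A by exact: mlogE hA eA.
rewrite lE; split=> //.
have [p pE] := log_pev hA; rewrite pE; apply: (pev_fixed D0).
by rewrite eA (econd_comp D0) setIid.
Qed.

Lemma mob_logZ_herm L Lam B : B `<=` active Lam -> herm (mob (logZ L Lam) B).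
Proof.
move=> BL; rewrite /herm (mob_morph _ _ (@adjD R _) (adj0 R _)).
apply: (@mob_ext _ _ B) => // C CB.
by have [] := logZ_props L (fsubset_trans CB BL).
Qed.

Lemma mob_logZ_econd L Lam B : B `<=` active Lam ->
  econd L (mob (logZ L Lam) B) = mob (logZ L Lam) B.
Proof.
move=> BL; rewrite (mob_morph _ _ (@econdD R V D D0 L Lam) (econd0 R D0 Lam L)).
apply: (@mob_ext _ _ B) => // C CB.
by have [] := logZ_props L (fsubset_trans CB BL).
Qed.

Lemma active_mono X Lam : X `<=` Lam -> active X `<=` active Lam.
Proof.
move=> XL; apply/fsubsetP => Y; rewrite !in_active => /and3P[YX -> ->].
by rewrite (fsubset_trans YX XL).
Qed.

Lemma emb_gham X Lam B : X `<=` Lam -> B `<=` active X ->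
  emb Lam (gham X B) = gham Lam B.
Proof.
move=> XL BX; rewrite /gham (emb_sum _ _ _ XL); apply: eq_big_seq => Y YB.
by rewrite /gint (embZ _ _ XL) (emb_trans _ (active_sub BX YB) XL).
Qed.

(** Independence of the volume: exponential and partial trace commute with embeddings, and the
    Hermitian logarithm is unique. *)
Lemma emb_logZ L X Lam B : X `<=` Lam -> B `<=` active X ->
  emb Lam (logZ L X B) = logZ L Lam B.
Proof.
move=> XL BX; have [hl _ el] := logZ_props L BX.
apply/esym; apply: mlogE; first exact: emb_herm.
rewrite -(emb_mexp XL hl) el -(econd_emb D0 _ _ XL) (emb_mexp XL (gham_herm BX)).
by rewrite (emb_gham XL BX).
Qed.

Lemma emb_mob_logZ L X Lam B : X `<=` Lam -> B `<=` active X ->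
  emb Lam (mob (logZ L X) B) = mob (logZ L Lam) B.
Proof.
move=> XL BX; have eD (Q P : Op X) := embD Q P XL.
rewrite (mob_morph _ _ eD (emb0 R D XL)).
apply: (@mob_ext _ _ B) => // C CB; exact: emb_logZ (fsubset_trans CB BX).
Qed.

(** Members of a family with union [X] are subsets of [X], so enlarging the volume adds no such
    family. *)
Lemma sum_cover (M : zmodType) X Lam (G : {fset {fset V}} -> M) : X `<=` Lam ->
  \sum_(B <- fpowerset (active X) | cover B == X) G B =
  \sum_(B <- fpowerset (active Lam) | cover B == X) G B.
Proof.
move=> XL; rewrite big_mkcond (big_fpowersetE _ (active_mono XL)) /=.
rewrite big_mkcond [RHS]big_mkcond; apply: eq_big_seq => B; rewrite fpowersetE => BL.
case: (boolP (B `<=` active X)) => // BX; case: eqP => // cB.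
case/negP: BX; apply/fsubsetP => Y YB; rewrite in_active.
have /activeP[_ -> ->] := fsubsetP BL _ YB; rewrite !andbT -cB.
by apply/fsubsetP => y yY; apply/coverP; exists Y.
Qed.

Lemma emb_eff_tail L X Lam : X `<=` Lam ->
  emb Lam (\sum_(B <- fpowerset (active X) | cover B == X) mob (logZ L X) B) =
  \sum_(B <- fpowerset (active Lam) | cover B == X) mob (logZ L Lam) B.
Proof.
move=> XL; rewrite (emb_sum _ _ _ XL) -(sum_cover _ XL).
rewrite big_seq_cond [RHS]big_seq_cond; apply: eq_bigr => B /andP[].
by rewrite fpowersetE => BX _; exact: emb_mob_logZ.
Qed.

Lemma eff_herm L : local_interaction (eff L).
Proof.
move=> X; rewrite /eff; apply: hermD.
  by case: ifP => _; [apply: hermZ; exact: Phi_herm|exact: herm0].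
rewrite /herm adj_sum big_seq_cond [RHS]big_seq_cond; apply: eq_bigr => B /andP[].
by rewrite fpowersetE => BX _; exact: mob_logZ_herm.
Qed.

Lemma eff_supported L X : supported_in (fsetIs X L) (eff L X).
Proof.
apply: (supported_econd D0); rewrite /eff (econdD D0); congr (_ + _).
  case: eqP => [X0|_]; last exact: econd0.
  rewrite (econdZ D0); congr (_ *: _); rewrite -[RHS](econd_id D0).
  by apply: (econd_ext D0) => -[x xX] /=; exfalso; move: xX; rewrite X0 inE.
rewrite (econd_sum D0) big_seq_cond [RHS]big_seq_cond; apply: eq_bigr => B /andP[].
by rewrite fpowersetE => BX _; exact: mob_logZ_econd.
Qed.

Lemma eff_local L L' X : fsetIs X L' = fsetIs X L -> eff L X = eff L' X.
Proof.
move=> LL'; rewrite /eff; congr (_ + _); suff -> : logZ L X = logZ L' X by [].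
apply/funext => B; rewrite /logZ; congr mlog; apply: (econd_ext D0) => x.
have := congr1 (fun A : {fset V} => val x \in A) LL'; rewrite !inE (valP x) /= => e.
by split=> /asboolP h; apply/asboolP; rewrite ?e// -e.
Qed.

(** The term of the empty set is fixed by [econd L] and leaves the expectation. For the rest, every
    family of active sets has exactly one union, a subset of [Lam], so summing over unions is
    summing over all families, and Moebius inversion applies. *)
Lemma log_ham L Lam :
  mlog (econd L (mexp (- rC beta *: ham Phi Lam))) = ham (eff L) Lam.
Proof.
have s0 : fset0 `<=` Lam by exact: fsub0set.
have hamE : - rC beta *: ham Phi Lam = gint Lam fset0 + gham Lam (active Lam).
  rewrite -rmorphN /ham scaler_sumr (bigD1_seq fset0) ?fset_uniq ?fpowersetE//=.
  congr (_ + _); rewrite /gham.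
  transitivity (\sum_(X <- fpowerset Lam | (X != fset0) && (Phi X != 0)) gint Lam X).
    rewrite big_mkcond [RHS]big_mkcond; apply: eq_big_seq => X.
    rewrite fpowersetE => XL; case: eqP => //= _; case: eqP => //= ->.
    by rewrite (emb0 _ _ XL) scaler0.
  rewrite -big_filter; apply: perm_big; apply: uniq_perm.
  - by rewrite filter_uniq// fset_uniq.
  - exact: fset_uniq.
  by move=> X; rewrite mem_filter !inE andbC.
have [hl fl el] := logZ_props L (fsubset_refl (active Lam)).
have h0 := gint_herm s0.
have g0 : econd L (gint Lam fset0) = gint Lam fset0.
  rewrite /gint (econdZ D0) (econd_emb D0 _ _ s0); congr (_ *: emb _ _).
  rewrite -[RHS](econd_id D0); apply: (econd_ext D0) => -[x xX] /=.
  by exfalso; move: xX; rewrite inE.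
have cm := gham_comm (fsubset_refl (active Lam)) s0.
have m0 : econd L (mexp (gint Lam fset0)) = mexp (gint Lam fset0).
  by have [p [-> _]] := mexp_pev h0 h0; exact: pev_fixed.
have aZ : AlgU (econd L (mexp (gham Lam (active Lam)))).
  apply: AlgUE; apply: AlgU_mexp; first exact: gham_herm.
  rewrite /gham big_seq_cond; elim/big_ind: _.
  - by apply: AlgU0; rewrite -(scale0r (Phi Lam)); exact: Alg0_scale.
  - exact: AlgUD.
  move=> X; rewrite andbT => XA; apply: AlgU0; apply: gint_Alg.
  exact: active_sub (fsubset_refl _) XA.
have c2 : gint Lam fset0 * logZ L Lam (active Lam) =
          logZ L Lam (active Lam) * gint Lam fset0.
  apply/esym; apply: (log_comm hl); rewrite el; apply: AlgUC => //.
  by apply: AlgU0; exact: gint_Alg.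
have lhs : mlog (econd L (mexp (- rC beta *: ham Phi Lam))) =
    gint Lam fset0 + logZ L Lam (active Lam).
  apply: mlogE; first exact: hermD.
  rewrite (mexpD h0 hl c2) el hamE (mexpD h0 (gham_herm (fsubset_refl _)) (esym cm)).
  by rewrite -{1}m0 -(econdMl D0) m0.
rewrite lhs /ham.
transitivity (\sum_(X <- fpowerset Lam)
   ((if X == fset0 then gint Lam X else 0) +
    \sum_(B <- fpowerset (active Lam) | cover B == X) mob (logZ L Lam) B)); last first.
  apply: eq_big_seq => X; rewrite fpowersetE => XL.
  rewrite /eff (embD _ _ XL) (emb_eff_tail _ XL); congr (_ + _).
  by case: ifP => _; rewrite ?(emb0 _ _ XL) ?(embZ _ _ XL).
rewrite big_split /=; congr (_ + _).
  rewrite (bigD1_seq fset0) ?fset_uniq ?fpowersetE//= ?eqxx big1 ?addr0//.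
  by move=> X /negbTE ->.
rewrite (exchange_big_dep xpredT)//= -(sum_mob (logZ L Lam)).
apply: eq_big_seq => B; rewrite fpowersetE => BL.
have cL : cover B `<=` Lam.
  apply/fsubsetP => x /coverP[X XB]; apply: (fsubsetP (active_sub BL XB)).
rewrite big_mkcond (bigD1_seq (cover B)) ?fset_uniq ?fpowersetE//= ?eqxx.
by rewrite big1 ?addr0// => X /negbTE; rewrite eq_sym => ->.
Qed.

(** [\esum] is a supremum over finite subsums, so a finite [F] suffices, and all its members fit in
    the single volume [cover F]. *)
Lemma sum_eff_le L x (F : {fset {fset V}}) : (forall X, X \in F -> x \in X) ->
  \sum_(X <- F) opnorm (eff L X) * expR (b X) <= 1.
Proof.
move=> Fx; pose Lam := cover F.
have FL X : X \in F -> X `<=` Lam.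
  by move=> XF; apply/fsubsetP => y yX; apply/coverP; exists X.
pose T B := wcover B * opnorm (mob (logZ L Lam) B).
have T0 B : 0 <= T B by rewrite mulr_ge0 ?opnorm_ge0// (le_trans _ (wcover_ge1 _)).
have step X : X \in F -> opnorm (eff L X) * expR (b X) <=
    \sum_(B <- fpowerset (active Lam) | cover B == X) T B.
  move=> XF; have XL := FL X XF; have xX := Fx X XF.
  have X0 : X != fset0 by apply/fset0Pn; exists x.
  apply: (@le_trans _ _ (opnorm (\sum_(B <- fpowerset (active Lam) | cover B == X)
      mob (logZ L Lam) B) * expR (b X))).
    rewrite ler_wpM2r ?expR_ge0// -(emb_eff_tail _ XL) /eff (negbTE X0) add0r.
    exact: le_opnorm_emb.
  apply: (@le_trans _ _ ((\sum_(B <- fpowerset (active Lam) | cover B == X)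
      opnorm (mob (logZ L Lam) B)) * expR (b X))).
    by rewrite ler_wpM2r ?expR_ge0//; exact: opnorm_sum.
  rewrite mulr_suml; apply: ler_sum => B /eqP cB; rewrite /T /wcover mulrC.
  case: eqP => [B0|_]; last by rewrite cB.
  by move: X0; rewrite -cB B0 /cover big_seq_fset0 eqxx.
(* A family whose union contains [x] has a member containing [x]; charging the family to its members
   through [x] brings in [cluster_active], at 1/d for each of them. *)
pose act := [fset Y in active Lam | x \in Y].
apply: (@le_trans _ _ (\sum_(B <- fpowerset (active Lam)) \sum_(Y <- act | Y \in B) T B)).
  apply: (@le_trans _ _ (\sum_(X <- F)
      \sum_(B <- fpowerset (active Lam) | cover B == X) T B)).
    by rewrite !big_seq; apply: ler_sum.
  rewrite (exchange_big_dep xpredT)//= !big_seq; apply: ler_sum => B.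
  rewrite fpowersetE => BL.
  have [cF|cF] := boolP (cover B \in F); last first.
    rewrite big1_seq ?sumr_ge0// => X /andP[/eqP cB XF].
    by rewrite cB XF in cF.
  rewrite big_mkcond (bigD1_seq (cover B)) ?fset_uniq//= ?eqxx big1 ?addr0; last first.
    by move=> X /negbTE; rewrite eq_sym => ->.
  have /coverP[Y YB xY] := Fx _ cF.
  have Yact : Y \in act by apply/imfsetP; exists Y => //; apply/andP; split=> //; exact: (fsubsetP BL).
  by rewrite big_mkcond (bigD1_seq Y) ?fset_uniq//= YB lerDl sumr_ge0// => Z _; case: ifP.
rewrite (exchange_big_dep xpredT)//=.
have [act0|[Y0 Y0a]] := fset_0Vmem act; first by rewrite act0 big_seq_fset0.
have [_ bd] := cluster_active L Lam.
have actP Y : Y \in act -> Y \in active Lam /\ x \in Y.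
  by rewrite in_fset => /andP[].
have d0 : (0 < d)%N by have [/active_d_gt0] := actP _ Y0a.
apply: (@le_trans _ _ (\sum_(Y <- act) (d%:R^-1 : R))).
  rewrite !big_seq; apply: ler_sum => Y /actP[YL _]; exact: bd.
rewrite big_const_seq count_predT iter_addr_0 -[leLHS]mulr_natl ler_pdivrMr ?ltr0n//.
rewrite mul1r ler_nat.
have [/activeP[_ _ P0] xY0] := actP _ Y0a.
(* All sets in [act] meet [Y0] at [x], so the degree of [Y0] bounds their number. *)
apply: (Phi_deg P0) => Y /actP[/activeP[_ _ PY] xY]; split=> //.
by apply/fset0Pn; exists x; rewrite inE xY.
Qed.

Lemma bnorm_eff L : (bnorm b (eff L) <= 1)%E.
Proof.
apply: ub_ereal_sup => _ [x _ <-]; apply: ub_ereal_sup => _ [F [finF Fx] <-].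
rewrite fsbig_finite//= sumEFin lee_fin.
by apply: (@sum_eff_le _ x) => X; rewrite in_fset_set// => /set_mem /Fx.
Qed.

End Main.

Unset Implicit Arguments.

(** The bound on [beta] is cleared of its denominator, which vanishes when [d] or the norm of [Phi]
    is 0. [Psi] is a function of the region, so that locality can compare two regions at the same
    [beta]. *)
Theorem theorem3p8 (R : realType) (V : choiceType) (D : nat)
    (Phi : interaction R V D) (b : {fset V} -> R) (d : nat) :
  (0 < D)%N ->
  local_interaction Phi ->
  commuting_hyp Phi ->
  (forall X, 0 <= b X) -> b_subadditive b ->
  (bnorm b Phi < +oo)%E ->
  finite_degree Phi d ->
  forall beta : R,
    `|beta| * ((d * (1 + d))%:R * expR 2 * fine (bnorm b Phi)) < 1 ->
    exists Psi : set V -> interaction R V D,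
      [/\ (forall L, local_interaction (Psi L)),
          (forall L X, supported_in (fsetIs X L) (Psi L X)),
          (forall L L' X, fsetIs X L' = fsetIs X L -> Psi L X = Psi L' X),
          (forall L Lam,
             mlog (econd L (mexp (- rC beta *: ham Phi Lam))) = ham (Psi L) Lam)
        & (forall L, (bnorm b (Psi L) <= 1)%E)].
Proof.
move=> D0 hPhi [Alg0 [aE aR aZ aP aC]] b0 bs bfin deg beta bsm.
exists (fun L X => eff Phi beta L X); split.
- move=> L; exact: (eff_herm D0 hPhi aE aR aZ aP aC b0 bs bfin deg bsm).
- move=> L X; exact: (eff_supported D0 hPhi aE aR aZ aP aC b0 bs bfin deg bsm).
- by move=> L L' X; exact: (eff_local _ _ D0).
- move=> L Lam; exact: (log_ham D0 hPhi aE aR aZ aP aC b0 bs bfin deg bsm).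
- move=> L; exact: (bnorm_eff D0 hPhi aE aR aZ aP aC b0 bs bfin deg bsm).
Qed.
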